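(* Let $(X_n)$ be a countable (finite or countably infinite) family of Polish spaces, $X=\prod_n X_n$ with the product topology, and for every $n$ let $\nu_n$ be a Borel probability measure on $X_n$. Let $\phi:B(\nu)\to\mathbb{R}$ be increasing and convex such that $$\phi(f)\le m+\sum_n\langle g_n,\nu_n\rangle$$ whenever $f\in B(\nu)$ satisfies $f\le m+\oplus g$ for some $m\in\mathbb{R}$ and $\oplus g\in G(\nu)$. Moreover, assume that $$\phi^*_{C_b}(\mu)=\phi^*_{U(\nu)}(\mu):=\sup_{f\in U(\nu)}\big(\langle f,\mu\rangle-\phi(f)\big)\quad\text{for all }\mu\in\mathcal{P}(\nu).$$ Then $$\phi(f)=\max_{\mu\in\mathcal{P}(\nu)}\big(\langle f,\mu\rangle-\phi^*_{C_b}(\mu)\big)\quad\text{for all } f\in B(\nu)\cap(U(\nu)+G(\nu)).$$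
   Context: $\mathcal{P}(\nu)$ is the set of all Borel probability measures $\mu$ on $X$ with marginals $\mu\circ\pi_n^{-1}=\nu_n$ for all $n$, where $\pi_n:X\to X_n$ is the $n$-th coordinate projection. $C_b$ is the set of bounded continuous and $B_b$ the set of bounded Borel measurable functions $X\to\mathbb{R}$; $B$ is the space of all Borel measurable functions $f:X\to\mathbb{R}$, $U\subseteq B$ the subset of upper semicontinuous functions $X\to\mathbb{R}$, and $B_n^+$ the set of all Borel measurable functions $X_n\to\mathbb{R}_+=[0,\infty)$. $\langle f,\mu\rangle:=\int f\,d\mu$. For $g=(g_n)\in\prod_n B_n^+$, $\oplus g:=\sum_n g_n\circ\pi_n:X\to\mathbb{R}_+\cup\{+\infty\}$. Define $$G(\nu):=\Big\{\oplus g:(g_n)\in\prod_n B_n^+\text{ such that }\sum_n\langle g_n,\nu_n\rangle<+\infty\Big\},$$ $$B(\nu):=\{f\in B:|f|\le\oplus g\text{ for some }\oplus g\in G(\nu)\},\qquad U(\nu):=\{f\in U:f^+\in B_b\text{ and }f^-\in B(\nu)\}.$$ $U(\nu)+G(\nu)$ is the set of functions $h+\oplus g$ with $h\in U(\nu)$, $\oplus g\in G(\nu)$. Inequalities between functions are pointwise; ''increasing'' means $\phi(f)\ge\phi(g)$ whenever $f\ge g$. $\phi^*_{C_b}(\mu):=\sup_{f\in C_b}(\langle f,\mu\rangle-\phi(f))$. *)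

(* Defs.v *)
From HB Require Import structures.
From mathcomp Require Import all_boot all_order all_algebra.
From mathcomp Require Import all_classical all_reals all_analysis.

Set Implicit Arguments.
Unset Strict Implicit.
Unset Printing Implicit Defensive.

Import Order.TTheory GRing.Theory Num.Theory.
Import numFieldNormedType.Exports.

Local Open Scope classical_set_scope.
Local Open Scope ring_scope.

Section Polish.
Context (R : realType) (T : topologicalType).

Definition is_metric (d : T -> T -> R) :=
  [/\ forall x y, 0 <= d x y,
      forall x y, d x y = 0 <-> x = y,
      forall x y, d x y = d y x
    & forall x y z, d x z <= d x y + d y z].

Definition metric_compatible (d : T -> T -> R) :=
  forall x, nbhs x = nbhs_ball_ (fun y e => [set z | d y z < e]) x.

Definition metric_complete (d : T -> T -> R) :=
  forall u : nat -> T,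
    (forall e, 0 < e -> exists N : nat,
      forall m n, (N <= m)%N -> (N <= n)%N -> d (u m) (u n) < e) ->
    exists l : T, u @ \oo --> l.

Definition polish_space :=
  (exists2 D : set T, countable D & dense D) /\
  (exists d : T -> T -> R,
    [/\ is_metric d, metric_compatible d & metric_complete d]).

End Polish.
Arguments polish_space : clear implicits.

Notation borel T := (g_sigma_algebraType (@open T)).

Definition upper_semicontinuous (R : realType) (T : topologicalType)
    (f : T -> R) :=
  forall x a, f x < a -> \forall y \near x, f y < a.

Definition is_maximum d (T : porderType d) (S : set T) (x : T) :=
  S x /\ ubound S x.

Section Spaces.
Context (R : realType) (I : countType) (X : I -> ptopologicalType).

Local Notation PX := (prod_topology X).

Definition borel_functions : set (PX -> R) :=
  [set f | measurable_fun [set: borel PX] (f : borel PX -> R)].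

Definition bounded_borel_functions : set (PX -> R) :=
  [set f | borel_functions f /\ bounded_fun f].

Definition bounded_continuous_functions : set (PX -> R) :=
  [set f | continuous f /\ bounded_fun f].

Definition usc_functions : set (PX -> R) :=
  [set f | borel_functions f /\ upper_semicontinuous f].

Definition nonneg_borel_functions (n : I) : set (X n -> R) :=
  [set g | measurable_fun [set: borel (X n)] (g : borel (X n) -> R) /\
           forall x, 0 <= g x].

Local Open Scope ereal_scope.

Definition oplus (g : forall n, X n -> R) (x : PX) : \bar R :=
  \esum_(n in [set: I]) (g n (proj n x))%:E.

Definition pairing d (T : measurableType d) (f : T -> R)
    (mu : probability T R) : \bar R := \int[mu]_x (f x)%:E.

Variable nu : forall n, probability (borel (X n)) R.

Definition couplings : set (probability (borel PX) R) :=
  [set mu | forall n A, measurable A ->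
     pushforward mu (proj n : borel PX -> borel (X n)) A = nu n A].

Definition sum_pairing (g : forall n, X n -> R) : \bar R :=
  \esum_(n in [set: I]) pairing (g n : borel (X n) -> R) (nu n).

Definition Gseq : set (forall n, X n -> R) :=
  [set g | (forall n, nonneg_borel_functions (g n)) /\ sum_pairing g < +oo].

Definition G_nu : set (PX -> \bar R) := [set oplus g | g in Gseq].

Definition B_nu : set (PX -> R) :=
  [set f | borel_functions f /\
     exists2 h, G_nu h & forall x, `|f x|%:E <= h x].

Definition U_nu : set (PX -> R) :=
  [set f | [/\ usc_functions f, bounded_borel_functions f^\+%R
             & B_nu f^\-%R]].

Definition U_plus_G_nu : set (PX -> \bar R) :=
  [set (fun x => (h x)%:E + k x) | h in U_nu & k in G_nu].

(* A functional on [B_nu] is represented by a total function, of which only the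
   values on [B_nu] matter: when [I] is nonempty, both
   [bounded_continuous_functions] and [U_nu] are included in [B_nu], so that
   [conjugate] below never reads [phi] outside [B_nu]. *)
Definition increasing_on_B_nu (phi : (PX -> R) -> R) :=
  forall f g, B_nu f -> B_nu g -> (forall x, g x <= f x)%R ->
    (phi g <= phi f)%R.

Definition convex_on_B_nu (phi : (PX -> R) -> R) :=
  forall f g (t : R), B_nu f -> B_nu g -> (0 <= t <= 1)%R ->
    (phi (fun x => t * f x + (1 - t) * g x) <=
     t * phi f + (1 - t) * phi g)%R.

Definition conjugate (S : set (PX -> R)) (phi : (PX -> R) -> R)
    (mu : probability (borel PX) R) : \bar R :=
  ereal_sup [set pairing (f : borel PX -> R) mu - (phi f)%:E | f in S].

End Spaces.
Arguments bounded_continuous_functions R {I} X.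

(* Main.v *)
Require Import Defs.
From HB Require Import structures.
From mathcomp Require Import all_boot all_order all_algebra finmap.
From mathcomp Require Import all_classical all_reals all_analysis measurable_realfun.
From mathcomp Require Import ring lra.

Set Implicit Arguments.
Unset Strict Implicit.
Unset Printing Implicit Defensive.

Import Order.TTheory GRing.Theory Num.Theory.
Import numFieldNormedType.Exports.

Local Open Scope classical_set_scope.

(** Fix [f] in [B_nu] of the form [h + oplus g] with [h] in [U_nu]. The theorem
    says that [<f, mu> - phi^* mu <= phi f] for every coupling [mu], with equality
    for some [mu].

    Existence of a maximizer ([subgradient_coupling_attains]). A convex
    real-valued function has a linear subgradient at every point, so there is a
    linear [L] on [B_nu] with [phi f + L k <= phi (f + k)]
    ([convex_subgradient]). Replacing [k] by [t k] and letting [t] grow, the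
    growth bound on [phi] passes to [L]: [L k <= m + sum_n <g_n, nu_n>] whenever
    [k <= m + oplus g] ([subgradient_marginal_dominated]). In particular [L] is
    positive and [L 1 = 1], it is a finitely additive probability with marginals
    dominated by the [nu n], and it is tight, because the marginals are
    ([ulam_tight], [product_tight]). On compact sets [K |-> L 1_K] is therefore a
    content of total mass [1], and it generates a Borel probability [mu]
    ([content_measure_exists]). On open sets [mu] lies below [L]; hence its
    marginals lie below the [nu n] on open sets and so are equal to them, and [mu]
    lies above [L] on upper semicontinuous functions bounded from above
    ([dominated_functional_coupling]). For bounded continuous [c] this yields
    [<c, mu> <= L c], while [L f = L h + L (oplus g) <= <f, mu>]; inserted in the
    subgradient inequality at [c] this is [<c, mu> - phi c <= <f, mu> - phi f].

    The inequality for an arbitrary coupling ([coupling_le]). The conjugate over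
    bounded continuous functions may be taken over [U_nu]. By inner regularity
    each [g n] has bounded upper semicontinuous minorants of almost the same
    [nu n]-integral ([integral_le_usc_minorants]); adding finitely many of these
    to [h] gives elements of [U_nu] below [f] whose integrals approach [<f, mu>],
    and [phi] is increasing. *)

(** * Subgradients of convex functions *)

Section Subgradient.
Local Open Scope ring_scope.
Context {R : realType} {V : lmodType R}.
Implicit Types (E : set V) (p q : V -> R).

Definition linear_subspace E :=
  [/\ E 0, forall x y, E x -> E y -> E (x + y)
    & forall (a : R) x, E x -> E (a *: x)].

Definition sublinear_on E q :=
  (forall x y, E x -> E y -> q (x + y) <= q x + q y) /\
  (forall (a : R) x, 0 <= a -> E x -> q (a *: x) <= a * q x).

Definition linear_on E q :=
  (forall x y, E x -> E y -> q (x + y) = q x + q y) /\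
  (forall (a : R) x, E x -> q (a *: x) = a * q x).

Lemma subspaceN E x : linear_subspace E -> E x -> E (- x).
Proof. by move=> [_ _ EZ] Ex; rewrite -scaleN1r; exact: EZ. Qed.

Lemma sublinear0 E q : linear_subspace E -> sublinear_on E q -> q 0 = 0.
Proof.
move=> [E0 _ _] [qD qZ]; apply/eqP; rewrite eq_le; apply/andP; split.
  by have := qZ 0 0 (lexx _) E0; rewrite scaler0 mul0r.
by have := qD 0 0 E0 E0; rewrite addr0; lra.
Qed.

Lemma sublinear_geN E q x : linear_subspace E -> sublinear_on E q -> E x ->
  - q (- x) <= q x.
Proof.
move=> Es qs Ex; have [qD _] := qs.
have := qD x (- x) Ex (subspaceN Es Ex).
by rewrite subrr (sublinear0 Es qs); lra.
Qed.

Lemma sublinearZ E q (a : R) x : linear_subspace E -> sublinear_on E q ->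
  0 <= a -> E x -> q (a *: x) = a * q x.
Proof.
move=> Es qs; rewrite le_eqVlt => /orP[/eqP <- _|a0 Ex].
  by rewrite scale0r mul0r (sublinear0 Es qs).
have [_ qZ] := qs; apply/eqP; rewrite eq_le (qZ _ _ (ltW a0))//=.
have [_ _ EZ] := Es.
have := qZ a^-1 (a *: x) _ (EZ _ _ Ex); rewrite invr_ge0 ltW// => /(_ isT).
by rewrite scalerA mulVf ?gt_eqF// scale1r ler_pdivlMl.
Qed.

(** Zorn's lemma applies because the infimum of a chain of sublinear functions
    is again sublinear: values at [x] are bounded below by [- p (- x)], and of
    any two members of the chain one lies below the other. *)
Lemma minimal_sublinear E p : linear_subspace E -> sublinear_on E p ->
  exists q, [/\ sublinear_on E q, forall x, E x -> q x <= p x &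
    forall r, sublinear_on E r -> (forall x, E x -> r x <= q x) ->
      forall x, E x -> q x <= r x].
Proof.
move=> Es ps.
pose T := {q : V -> R | sublinear_on E q /\ forall x, E x -> q x <= p x}.
pose le_T (s t : T) := `[< forall x, E x -> sval t x <= sval s x >].
have pp : sublinear_on E p /\ (forall x, E x -> p x <= p x) by split.
have [||A Atot|[q [qs qp]] qmin] := @ZL_preorder T (exist _ p pp) le_T.
- by move=> s; apply/asboolP => x Ex; exact: lexx.
- move=> r s t /asboolP rs /asboolP st; apply/asboolP => x Ex.
  exact: le_trans (st _ Ex) (rs _ Ex).
- have [[s0 As0]|A0] := pselect (exists s, A s); last first.
    exists (exist _ p pp) => s As; exfalso; apply: A0; by exists s.
  pose S x := [set sval s x | s in A].
  have Slb x : E x -> has_lbound (S x).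
    move=> Ex; exists (- p (- x)) => _ [[s [ss sp]] _ <-] /=.
    apply: le_trans (sublinear_geN Es ss Ex); rewrite lerN2.
    by apply: sp; exact: subspaceN.
  have Sinf x s : E x -> A s -> inf (S x) <= sval s x.
    by move=> Ex As; apply: ge_inf; [exact: Slb|exists s].
  have [E0 ED EZ] := Es.
  have infs : sublinear_on E (inf \o S) /\
      forall x, E x -> (inf \o S) x <= p x.
    split; last first.
      move=> x Ex; apply: le_trans (Sinf _ _ Ex As0) _.
      by case: s0 {As0} => s [ss sp]; exact: sp.
    split => [x y Ex Ey|a x a0 Ex] /=.
      have xs1 s1 : A s1 -> inf (S (x + y)) - sval s1 x <= inf (S y).
        move=> As1; apply: lb_le_inf; first by exists (sval s0 y), s0.
        move=> _ [s2 As2 <-].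
        have [/asboolP s12|/asboolP s21] := Atot _ _ As1 As2.
          have := Sinf _ _ (ED _ _ Ex Ey) As2; have := s12 _ Ex.
          by case: s2 {s12 As2} => s [[sD sZ] sp]/=; have := sD _ _ Ex Ey; lra.
        have := Sinf _ _ (ED _ _ Ex Ey) As1; have := s21 _ Ey.
        by case: s1 {s21 As1} => s [[sD sZ] sp]/=; have := sD _ _ Ex Ey; lra.
      rewrite -lerBlDr; apply: lb_le_inf; first by exists (sval s0 x), s0.
      by move=> _ [s1 As1 <-]; have := xs1 _ As1; lra.
    have axs s : A s -> inf (S (a *: x)) <= a * sval s x.
      move=> As; apply: le_trans (Sinf _ _ (EZ _ _ Ex) As) _.
      by case: s {As} => s [[sD sZ] sp]; exact: sZ.
    move: a0; rewrite le_eqVlt => /orP[/eqP a0|a0].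
      by have := axs _ As0; rewrite -a0 !mul0r.
    rewrite -ler_pdivrMl//; apply: lb_le_inf; first by exists (sval s0 x), s0.
    by move=> _ [s As <-]; rewrite ler_pdivrMl//; exact: axs.
  pose t : T := exist _ (inf \o S) infs.
  by exists t => s As; apply/asboolP => x Ex; exact: Sinf.
- exists q; split=> // r rs rq x Ex.
  have rp : sublinear_on E r /\ forall x, E x -> r x <= p x.
    by split=> // y Ey; exact: le_trans (rq _ Ey) (qp _ Ey).
  have rle : le_T (exist _ q (conj qs qp)) (exist _ r rp) by apply/asboolP.
  by have /asboolP/(_ _ Ex) := qmin _ rle.
Qed.

(** Minimality of [q] forces additivity: lowering [q] along a direction [y] by
    [x |-> inf_(t >= 0) (q (x + t y) - t q y)] gives a sublinear function, hence
    does not change [q], and [t = 1] yields [q x + q y <= q (x + y)]. *)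
Lemma hahn_banach_on E p : linear_subspace E -> sublinear_on E p ->
  exists2 L, linear_on E L & forall x, E x -> L x <= p x.
Proof.
move=> Es ps; have [q [qs qp qmin]] := minimal_sublinear Es ps.
have [E0 ED EZ] := Es; have [qD qZ] := qs.
have qadd x y : E x -> E y -> q (x + y) = q x + q y.
  move=> Ex Ey; apply/eqP; rewrite eq_le qD//=.
  pose S x := [set q (x + t *: y) - t * q y | t in [set t : R | 0 <= t]].
  have Slb z : E z -> has_lbound (S z).
    move=> Ez; exists (- q (- z)) => _ [t /= t0 <-].
    have Ety := EZ t y Ey.
    have := qD _ _ (ED _ _ Ez Ety) (subspaceN Es Ez).
    by rewrite addrAC subrr add0r (sublinearZ Es qs t0 Ey); lra.
  have Sn0 z : S z !=set0.
    by exists (q (z + 0 *: y) - 0 * q y), 0 => //=.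
  have Sinf z t : E z -> 0 <= t -> inf (S z) <= q (z + t *: y) - t * q y.
    by move=> Ez t0; apply: ge_inf; [exact: Slb|exists t].
  have rs : sublinear_on E (inf \o S).
    split=> [z w Ez Ew|a z a0 Ez] /=.
      rewrite -lerBlDr; apply: lb_le_inf => // _ [t /= t0 <-].
      rewrite lerBlDr -lerBlDl; apply: lb_le_inf => // _ [u /= u0 <-].
      have := Sinf _ _ (ED _ _ Ez Ew) (addr_ge0 t0 u0).
      have := qD _ _ (ED _ _ Ez (EZ t _ Ey)) (ED _ _ Ew (EZ u _ Ey)).
      by rewrite addrACA -scalerDl; lra.
    have aSt t : 0 <= t ->
        inf (S (a *: z)) <= a * (q (z + t *: y) - t * q y).
      move=> t0; have := Sinf _ _ (EZ a _ Ez) (mulr_ge0 a0 t0).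
      have := qZ a _ a0 (ED _ _ Ez (EZ t _ Ey)).
      by rewrite scalerDr scalerA; lra.
    move: a0; rewrite le_eqVlt => /orP[/eqP a0|a0].
      by have := aSt 0 (lexx _); rewrite -a0 !mul0r.
    rewrite -ler_pdivrMl//; apply: lb_le_inf => // _ [t /= t0 <-].
    by rewrite ler_pdivrMl//; exact: aSt.
  have rq z : E z -> (inf \o S) z <= q z.
    by move=> Ez; have := Sinf _ _ Ez (lexx 0); rewrite scale0r addr0 mul0r subr0.
  have := qmin _ rs rq x Ex; have /= := Sinf _ _ Ex ler01.
  by rewrite scale1r mul1r; lra.
have qN x : E x -> q (- x) = - q x.
  move=> Ex; have := qadd _ _ Ex (subspaceN Es Ex).
  by rewrite subrr (sublinear0 Es qs); lra.
exists q => //; split=> // a x Ex; have [a0|/ltW a0] := leP 0 a.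
  exact: sublinearZ Es qs a0 Ex.
have Na0 : 0 <= - a by rewrite oppr_ge0.
have := sublinearZ Es qs Na0 Ex; rewrite scaleNr qN ?mulNr; last exact: EZ.
by move/oppr_inj.
Qed.

(** The difference quotients of a convex function along a ray decrease to a
    sublinear function of the direction; a linear minorant of it is a
    subgradient. *)
Lemma convex_subgradient E (phi : V -> R) x0 : linear_subspace E -> E x0 ->
  (forall x y (t : R), E x -> E y -> 0 <= t <= 1 ->
    phi (t *: x + (1 - t) *: y) <= t * phi x + (1 - t) * phi y) ->
  exists2 L, linear_on E L & forall x, E x -> phi x0 + L x <= phi (x0 + x).
Proof.
move=> Es Ex0 cphi; have [E0 ED EZ] := Es.
pose Q x t := (phi (x0 + t *: x) - phi x0) / t.
pose S x := [set Q x t | t in [set t : R | 0 < t]].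
have Slb x : E x -> has_lbound (S x).
  (* [x0] lies between [x0 + t x] and [x0 - x], which bounds the slopes. *)
  move=> Ex; exists (phi x0 - phi (x0 - x)) => _ [t /= t0 <-].
  have t1 : 0 < 1 + t by rewrite addr_gt0.
  have Etx : E (x0 + t *: x) by apply: ED => //; exact: EZ.
  have Ex0x : E (x0 - x) by apply: ED => //; exact: subspaceN.
  have := cphi _ _ (1 + t)^-1 Etx Ex0x.
  rewrite invr_ge0 ltW//= invf_le1// lerDl ltW// => /(_ isT).
  have -> : (1 + t)^-1 *: (x0 + t *: x) + (1 - (1 + t)^-1) *: (x0 - x) = x0.
    have -> : 1 - (1 + t)^-1 = (1 + t)^-1 * t by field; rewrite gt_eqF.
    rewrite -scalerA -scalerDr scalerBr addrACA subrr addr0.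
    rewrite -{1}[x0]scale1r -scalerDl scalerA.
    by rewrite mulVf ?gt_eqF// scale1r.
  rewrite /Q ler_pdivlMr// -(ler_pM2l t1) mulrDr !mulrA mulrBr.
  by rewrite mulfV ?gt_eqF//; lra.
have Sn0 x : S x !=set0 by exists (Q x 1), 1 => //=.
have Sinf x t : E x -> 0 < t -> inf (S x) <= Q x t.
  by move=> Ex t0; apply: ge_inf; [exact: Slb|exists t].
have ps : sublinear_on E (inf \o S).
  split=> [x y Ex Ey|a x a0 Ex] /=.
    rewrite -lerBlDr; apply: lb_le_inf => // _ [s /= s0 <-].
    rewrite lerBlDr -lerBlDl; apply: lb_le_inf => // _ [t /= t0 <-].
    have st0 : 0 < s + t by rewrite addr_gt0.
    (* The weights [t / (s + t)] and [s / (s + t)] average [x0 + s x] and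
       [x0 + t y] to [x0 + r (x + y)]. *)
    pose r := s * t / (s + t).
    have r0 : 0 < r by rewrite divr_gt0// mulr_gt0.
    have := Sinf _ _ (ED _ _ Ex Ey) r0.
    have Esx : E (x0 + s *: x) by apply: ED => //; exact: EZ.
    have Ety : E (x0 + t *: y) by apply: ED => //; exact: EZ.
    have t01 : 0 <= t / (s + t) <= 1.
      by rewrite ler_pdivrMr// mul1r lerDr (ltW s0) divr_ge0// ltW.
    have := cphi _ _ (t / (s + t)) Esx Ety t01.
    have -> : t / (s + t) *: (x0 + s *: x) +
        (1 - t / (s + t)) *: (x0 + t *: y) = x0 + r *: (x + y).
      rewrite !scalerDr addrACA -scalerDl [t / _ + _]addrC subrK scale1r !scalerA.
      congr (_ + (_ *: _ + _ *: _)); rewrite /r; first by field; rewrite gt_eqF.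
      by field; rewrite gt_eqF.
    move=> c1 c2; rewrite lerBlDl; apply: le_trans c2 _.
    rewrite /Q ler_pdivrMr// /r.
    set A := phi (x0 + s *: x) in c1 *; set B := phi (x0 + t *: y) in c1 *.
    have -> : ((A - phi x0) / s + (B - phi x0) / t) * (s * t / (s + t)) =
       t / (s + t) * A + (1 - t / (s + t)) * B - phi x0.
      by field; rewrite !gt_eqF.
    by rewrite lerB.
  have aSt t : 0 < t -> inf (S (a *: x)) <= a * Q x t.
    move=> t0; move: a0; rewrite le_eqVlt => /orP[/eqP a0|a0].
      have := Sinf _ _ (EZ a _ Ex) t0; rewrite -a0 /Q.
      by rewrite scale0r scaler0 addr0 subrr !mul0r.
    have := Sinf _ (t / a) (EZ a _ Ex); rewrite divr_gt0// => /(_ isT).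
    rewrite /Q scalerA divfK ?gt_eqF// invf_div; lra.
  move: a0; rewrite le_eqVlt => /orP[/eqP a0|a0].
    by have := aSt 1 ltr01; rewrite -a0 !mul0r.
  rewrite -ler_pdivrMl//; apply: lb_le_inf => // _ [t /= t0 <-].
  by rewrite ler_pdivrMl//; exact: aSt.
have [L Ll Lp] := hahn_banach_on Es ps.
exists L => // x Ex; have := le_trans (Lp _ Ex) (Sinf _ _ Ex ltr01).
by rewrite /Q scale1r divr1; lra.
Qed.

End Subgradient.

(** * Measures generated by contents on compact sets *)

Section ContentOnCompacts.
Local Open Scope ereal_scope.

(** If the closure of every neighborhood of [x] met the compact set [K `\` U],
    these traces would generate a filter with a cluster point in [K `\` U], and
    in a Hausdorff space this point can only be [x]. *)
Lemma compact_point_closure (T : topologicalType) (K U : set T) x :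
  hausdorff_space T -> compact K -> open U -> K x -> U x ->
  exists W, [/\ open W, W x & closure W `&` K `<=` U].
Proof.
move=> hT cK oU Kx Ux.
suff [W [Wx WU]] : exists W, nbhs x W /\ closure W `&` K `<=` U.
  exists (interior W); split => //; first exact: open_interior.
  by apply: subset_trans WU; apply: setSI; apply: closureS; exact: interior_subset.
apply: contrapT => /forallNP noW.
have ne (W : set T) : nbhs x W -> (closure W `&` (K `\` U)) !=set0.
  move=> Wx; have /not_andP[//|] := noW W.
  by move=> /existsNP[z /not_implyP[[? ?] ?]]; exists z.
pose F := filter_from (nbhs x) (fun W => closure W `&` (K `\` U)).
have PF : ProperFilter F.
  apply: filter_from_proper => //; apply: filter_from_filter.
    by exists setT; exact: filterT.
  move=> P Q xP xQ; exists (P `&` Q); first exact: filterI.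
  by move=> z [/closureI[Pz Qz] KUz].
have cKU : compact (K `\` U).
  apply: (subclosed_compact _ cK); last by move=> z [].
  by apply: closedI; [exact: compact_closed|exact: open_closedC].
have FKU : F (K `\` U) by exists setT; [exact: filterT|move=> z []].
have [z [[Kz Uz] Fz]] := cKU F PF FKU.
have xz : x = z.
  apply: hT => A B xA zB.
  have [V [oV Vz VB]] : exists V, [/\ open V, V z & V `<=` B].
    exists (interior B); split; [exact: open_interior|exact: zB|].
    exact: interior_subset.
  have FA : F (closure A) by exists A => // t [].
  have /(Fz _ _ FA) [t [At Vt]] : nbhs z V by exact: open_nbhs_nbhs.
  have /(At _) [s [As Vs]] : nbhs t V by exact: open_nbhs_nbhs.
  by exists s; split => //; exact: VB.
by apply: Uz; rewrite -xz.
Qed.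

(** Every point of [K] has a neighborhood whose closure stays, within [K], in one
    of the [U j]; grouping by [j] the finitely many closures that cover [K] gives
    the compact pieces. This is what makes a content countably subadditive on
    open sets. *)
Lemma compact_open_cover_split (T : ptopologicalType) (K : set T)
    (U : (set T)^nat) : hausdorff_space T -> compact K ->
  (forall j, open (U j)) -> K `<=` \bigcup_j U j ->
  exists (N : nat) (C : (set T)^nat),
    (forall j, compact (C j) /\ C j `<=` U j) /\
    K `<=` \big[setU/set0]_(j < N) C j.
Proof.
move=> hT cK oU KU.
have pickW x : exists jW : nat * set T, K x ->
    [/\ open jW.2, jW.2 x & closure jW.2 `&` K `<=` U jW.1].
  have [Kx|Kx] := pselect (K x); last by exists (0%N, set0) => /Kx.
  have [j _ Ux] := KU _ Kx.
  by have [W ?] := compact_point_closure hT cK (oU j) Kx Ux; exists (j, W).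
have [jW jWP] := choice pickW.
have cover_K : cover_compact K by rewrite -compact_cover.
have [x Kx|x Kx|D DK KD] := cover_K T K (fun x => (jW x).2).
- by have [] := jWP _ Kx.
- by exists x => //; have [] := jWP _ Kx.
pose J j := [set` D] `&` [set x | (jW x).1 = j].
pose C j := K `&` \bigcup_(x in J j) closure (jW x).2.
exists (\max_(x <- D) (jW x).1)%N.+1, C; split => [j|x Kx].
  split; last first.
    move=> z [Kz [x [/= Dx <-] xz]].
    by have [_ _] := jWP x (set_mem (DK _ Dx)); apply; split.
  apply: (subclosed_compact _ cK); last by move=> z [].
  apply: closedI; first exact: compact_closed.
  apply: closed_bigcup => [|x _]; last exact: closed_closure.
  by apply: finite_setIl; exact: finite_fset.
have [y /= Dy yx] := KD _ Kx.
rewrite -bigcup_mkord; exists (jW y).1 => /=.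
  by rewrite ltnS (leq_bigmax_seq y).
split => //; exists y => //; exact: subset_closure.
Qed.

(** Halmos' notion of a content, with finite values. *)
Definition compact_content (R : realType) (T : topologicalType)
    (lam : set T -> R) := [/\ forall K, compact K -> (0 <= lam K)%R,
  forall K L, compact K -> compact L -> K `<=` L -> (lam K <= lam L)%R,
  forall K L, compact K -> compact L -> (lam (K `|` L) <= lam K + lam L)%R
  & forall K L, compact K -> compact L -> K `&` L = set0 ->
      (lam K + lam L <= lam (K `|` L))%R].

Section OuterMeasure.
Context {R : realType} {T : ptopologicalType} {lam : set T -> R}.
Context (hT : hausdorff_space T) (lamC : compact_content lam).
Context (lam1 : forall K, compact K -> (lam K <= 1)%R).

Definition inner_content (U : set T) : \bar R :=
  ereal_sup [set (lam K)%:E | K in [set K | compact K /\ K `<=` U]].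

Definition outer_content (A : set T) : \bar R :=
  ereal_inf [set inner_content U | U in [set U | open U /\ A `<=` U]].

Lemma content_set0 : lam set0 = 0%R.
Proof.
have [lam0 _ _ lamD] := lamC; have c0 := @compact0 T.
apply/eqP; rewrite eq_le lam0// andbT.
by have := lamD _ _ c0 c0 (setI0 _); rewrite setU0; lra.
Qed.

Lemma inner_content_ge (K U : set T) : compact K -> K `<=` U ->
  (lam K)%:E <= inner_content U.
Proof. by move=> cK KU; apply: ereal_sup_ubound; exists K. Qed.

Lemma inner_content_ge0 (U : set T) : 0 <= inner_content U.
Proof.
have := inner_content_ge (@compact0 T) (@sub0set _ U).
by rewrite content_set0.
Qed.

Lemma le_inner_content (U V : set T) : U `<=` V ->
  inner_content U <= inner_content V.
Proof.
move=> UV; apply: ge_ereal_sup => _ [K [cK KU] <-].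
by apply: inner_content_ge => //; exact: subset_trans UV.
Qed.

Lemma inner_content_le1 (U : set T) : inner_content U <= 1.
Proof.
by apply: ge_ereal_sup => _ [K [cK _] <-]; rewrite lee_fin; exact: lam1.
Qed.

Lemma inner_content_fin (U : set T) : inner_content U \is a fin_num.
Proof.
rewrite ge0_fin_numE ?inner_content_ge0//.
exact: le_lt_trans (inner_content_le1 _) (ltry _).
Qed.

Lemma inner_content_adherent (U : set T) (e : R) : (0 < e)%R ->
  exists2 K, compact K /\ K `<=` U & inner_content U <= (lam K)%:E + e%:E.
Proof.
move=> e0; have [_ [K KU <-] Ue] := ub_ereal_sup_adherent e0 (inner_content_fin U).
by exists K => //; rewrite -leeBlDr//; exact: ltW.
Qed.

Lemma inner_content_bigcup (U : (set T)^nat) : (forall j, open (U j)) ->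
  inner_content (\bigcup_j U j) <= \sum_(j <oo) inner_content (U j).
Proof.
move=> oU; apply: ge_ereal_sup => _ [K [cK KU] <-].
have [N [C [CP KC]]] := compact_open_cover_split hT cK oU KU.
have [lam0 lam_le lamU _] := lamC.
have cC n : compact (\big[setU/set0]_(j < n) C j).
  elim: n => [|n ih]; first by rewrite big_ord0; exact: compact0.
  by rewrite big_ord_recr/=; apply: compactU => //; exact: (CP n).1.
have lamC_le n :
    (lam (\big[setU/set0]_(j < n) C j) <= \sum_(j < n) lam (C j))%R.
  elim: n => [|n ih]; first by rewrite !big_ord0 content_set0.
  rewrite !big_ord_recr/=; apply: (le_trans (lamU _ _ (cC n) (CP n).1)).
  by rewrite lerD2r.
apply: (@le_trans _ _ (\sum_(j < N) lam (C j))%:E).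
  rewrite lee_fin; apply: le_trans (lamC_le N); exact: lam_le (cC N) KC.
rewrite -sumEFin -(big_mkord xpredT (fun j => (lam (C j))%:E)).
apply: (@le_trans _ _ (\sum_(0 <= j < N) inner_content (U j))).
  by apply: lee_sum => j _; have [cCj CU] := CP j; exact: inner_content_ge.
by apply: nneseries_lim_ge => j _ _; exact: inner_content_ge0.
Qed.

Lemma outer_content_open (U : set T) : open U ->
  outer_content U = inner_content U.
Proof.
move=> oU; apply/eqP; rewrite eq_le; apply/andP; split.
  by apply: ereal_inf_lbound; exists U => //; split.
apply: le_ereal_inf_tmp => _ [V [oV UV] <-]; exact: le_inner_content.
Qed.

Lemma outer_content_ge0 (A : set T) : 0 <= outer_content A.
Proof. by apply: le_ereal_inf_tmp => _ [U _ <-]; exact: inner_content_ge0. Qed.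

Lemma outer_content0 : outer_content set0 = 0.
Proof.
rewrite outer_content_open; last exact: open0.
apply/eqP; rewrite eq_le inner_content_ge0 andbT.
apply: ge_ereal_sup => _ [K [_ + <-]]; rewrite subset0 => ->.
by rewrite content_set0.
Qed.

Lemma le_outer_content : {homo outer_content : A B / A `<=` B >-> A <= B}.
Proof.
move=> A B AB; apply: le_ereal_inf_tmp => _ [U [oU BU] <-].
by apply: ereal_inf_lbound; exists U => //; split=> //; exact: subset_trans BU.
Qed.

Lemma outer_content_fin (A : set T) : outer_content A \is a fin_num.
Proof.
rewrite ge0_fin_numE ?outer_content_ge0//.
apply: (@le_lt_trans _ _ (outer_content setT)); first exact: le_outer_content.
rewrite outer_content_open; last exact: openT.
exact: le_lt_trans (inner_content_le1 _) (ltry _).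
Qed.

Lemma outer_content_adherent (A : set T) (e : R) : (0 < e)%R ->
  exists U, [/\ open U, A `<=` U & inner_content U <= outer_content A + e%:E].
Proof.
move=> e0.
have [_ [U [oU AU] <-] Ue] := lb_ereal_inf_adherent e0 (outer_content_fin A).
by exists U; split => //; exact: ltW.
Qed.

Lemma outer_content_sigma_subadditive : sigma_subadditive outer_content.
Proof.
move=> A; apply/lee_addgt0Pr => e e0.
apply: le_trans (epsilon_trick _ _ (ltW e0)); last first.
  by move=> n; exact: outer_content_ge0.
have en0 n : (0 < e / (2 ^ n.+1)%:R)%R.
  by rewrite divr_gt0// ltr0n expn_gt0.
have [U UP] := choice (fun n => outer_content_adherent (A n) (en0 n)).
apply: (@le_trans _ _ (inner_content (\bigcup_n U n))).
  rewrite -outer_content_open; last first.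
    by apply: bigcup_open => n _; have [] := UP n.
  apply: le_outer_content => x [n _ Anx]; exists n => //.
  by have [_ + _] := UP n; apply.
apply: le_trans (inner_content_bigcup _) _.
  by move=> n; have [oUn _ _] := UP n.
apply: lee_nneseries => n *; first exact: inner_content_ge0.
by have [_ _] := UP n.
Qed.

HB.instance Definition _ := isOuterMeasure.Build R T outer_content
  outer_content0 outer_content_ge0 le_outer_content
  outer_content_sigma_subadditive.

(** Inside an open [V] containing [A], exhaust [V `&` U] by a compact [K] and
    then the open set [V `\` K], which contains [A `\` U], by a compact [L]; the
    content is additive on the disjoint pair [K], [L]. *)
Lemma open_caratheodory (U : set T) : open U ->
  outer_content.-caratheodory U.
Proof.
move=> oU; apply: (@le_caratheodory_measurable _ _ outer_content) => A.
apply: le_ereal_inf_tmp => _ [V [oV AV] <-]; apply/lee_addgt0Pr => e e0.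
have e20 : (0 < e / 2)%R by rewrite divr_gt0.
have [K [cK KVU] Ke] := inner_content_adherent (V `&` U) e20.
have [L [cL LVK] Le] := inner_content_adherent (V `\` K) e20.
have oVK : open (V `\` K).
  by apply: openI => //; apply: closed_openC; exact: compact_closed.
have AU : outer_content (A `&` U) <= (lam K)%:E + (e / 2)%:E.
  apply: le_trans Ke; rewrite -outer_content_open; last exact: openI.
  by apply: le_outer_content; exact: setSI.
have ANU : outer_content (A `&` ~` U) <= (lam L)%:E + (e / 2)%:E.
  apply: le_trans Le; rewrite -outer_content_open//.
  apply: le_outer_content => x [/AV Vx Ux]; split => // /KVU[_]; exact: Ux.
apply: le_trans (leeD AU ANU) _.
have [_ _ _ lamD] := lamC.
have KL0 : K `&` L = set0.
  by apply/seteqP; split => // x [Kx /LVK[_]]; exact.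
have KLV : (lam (K `|` L))%:E <= inner_content V.
  apply: inner_content_ge; first exact: compactU.
  by move=> x [/KVU[]|/LVK[]].
apply: le_trans (leeD2r e%:E KLV).
rewrite -!EFinD lee_fin; have := lamD _ _ cK cL KL0; lra.
Qed.

Lemma borel_caratheodory (A : set T) : <<s @open T >> A ->
  outer_content.-caratheodory A.
Proof.
pose mu : outer_measure R T := outer_content.
suff : <<s @open T >> `<=` mu.-cara.-measurable by apply.
apply: smallest_sub; last by move=> U oU; exact: open_caratheodory.
split => //.
- by move=> X mX; rewrite setTD; exact: (@measurableC _ (caratheodory_type mu)).
- move=> F mF; exact: (@bigcupT_measurable _ (caratheodory_type mu)).
Qed.

Definition content_measure : set (borel T) -> \bar R := outer_content.

Let content_measure_sigma_additive : semi_sigma_additive content_measure.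
Proof.
move=> F mF tF mUF.
apply: (@caratheodory_measure_sigma_additive _ _ outer_content) => //.
  by move=> n; exact: borel_caratheodory (mF n).
exact: borel_caratheodory mUF.
Qed.

HB.instance Definition _ := isMeasure.Build _ _ _ content_measure
  outer_content0 outer_content_ge0 content_measure_sigma_additive.

Context (lam_tight :
  forall e : R, (0 < e)%R -> exists2 K, compact K & (1 - e <= lam K)%R).

Let content_measure_setT : content_measure setT = 1.
Proof.
rewrite /content_measure outer_content_open; last exact: openT.
apply/eqP; rewrite eq_le inner_content_le1/=; apply/lee_addgt0Pr => e e0.
have [K cK Ke] := lam_tight e0.
have := inner_content_ge cK (@subsetT _ K).
move=> /(leeD2r e%:E); apply: le_trans.
by rewrite -EFinD lee_fin; lra.
Qed.

HB.instance Definition _ := Measure_isProbability.Build _ _ _ content_measure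
  content_measure_setT.

(** What the applications retain of the construction: domination on open sets and
    outer regularity. *)
Lemma content_measure_exists : exists mu : probability (borel T) R,
  (forall U (c : R), open U ->
    (forall K, compact K -> K `<=` U -> (lam K <= c)%R) -> mu U <= c%:E) /\
  (forall (A : set T) (e : R), (0 < e)%R ->
    exists U, [/\ open U, A `<=` U & mu U <= mu A + e%:E]).
Proof.
exists (content_measure : probability (borel T) R); split => [U c oU lamU|A e e0].
  rewrite /= /content_measure outer_content_open//.
  by apply: ge_ereal_sup => _ [K [cK KU] <-]; rewrite lee_fin lamU.
have [U [oU AU Ue]] := outer_content_adherent A e0.
by exists U; split => //; rewrite /= /content_measure outer_content_open.
Qed.

End OuterMeasure.

End ContentOnCompacts.

(** * Integrals from superlevel sets *)

Section LayerCake.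
Local Open Scope ring_scope.
Context {R : realType}.

Lemma sum_lt_nat_le (z : R) N : 0 <= z ->
  \sum_(i < N) (i.+1%:R < z)%R%:R <= z :> R.
Proof.
move=> z0; elim: N => [|N ih]; first by rewrite big_ord0.
have leN M : \sum_(i < M) (i.+1%:R < z)%R%:R <= M%:R :> R.
  elim: M => [|M ihM]; first by rewrite big_ord0.
  by rewrite big_ord_recr/= -natr1 lerD//; case: (_ < _).
rewrite big_ord_recr/=; have [Nz|_] := ltP; last by rewrite addr0.
by apply: le_trans (ltW Nz); rewrite -natr1 lerD2r leN.
Qed.

Lemma min_le_sum_lt_nat (z : R) N :
  Num.min z N%:R <= \sum_(i < N) (i.+1%:R < z)%R%:R + 1.
Proof.
have eqN M : M%:R < z -> \sum_(i < M) (i.+1%:R < z)%R%:R = M%:R :> R.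
  move=> Mz; rewrite -[in RHS](card_ord M) -sumr_const.
  by apply: eq_bigr => i _; rewrite (le_lt_trans _ Mz)// ler_nat.
elim: N => [|N ih]; first by rewrite big_ord0 ge_min add0r ler01 orbT.
have [zN|Nz] := leP z N%:R.
  rewrite ge_min; apply/orP; left.
  move: ih; rewrite min_l// big_ord_recr/= => /le_trans; apply.
  by rewrite lerD2r lerDl; case: (_ < _).
rewrite big_ord_recr/= eqN// ge_min -natr1; apply/orP; right.
by rewrite lerD2r lerDl; case: (_ < _).
Qed.

Lemma indic_layer (T : Type) (w : T -> R) (k i : nat) x : (0 < k)%N ->
  \1_[set y | i.+1%:R / k%:R < w y] x = (i.+1%:R < k%:R * w x)%R%:R :> R.
Proof.
move=> k0; rewrite indicE.
have -> // : (x \in [set y | i.+1%:R / k%:R < w y]) = (i.+1%:R < k%:R * w x)%R.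
by apply/idP/idP; rewrite inE /= ltr_pdivrMr ?ltr0n// mulrC.
Qed.

Lemma sum_layers_le (T : Type) (w : T -> R) (k N : nat) x : (0 < k)%N ->
  0 <= w x -> \sum_(i < N) \1_[set y | i.+1%:R / k%:R < w y] x <= k%:R * w x.
Proof.
move=> k0 w0; under eq_bigr do rewrite indic_layer//.
by apply: sum_lt_nat_le; rewrite mulr_ge0.
Qed.

Local Open Scope ereal_scope.

Lemma measurable_superlevel d (T : measurableType d) (w : T -> R) (a : R) :
  measurable_fun setT w -> measurable [set x | (a < w x)%R].
Proof.
move=> mw; have := mw measurableT _ (measurable_itv `]a, +oo[).
rewrite setTI; congr measurable.
by apply/seteqP; split => x /=; rewrite in_itv/= andbT.
Qed.

Lemma integral_sum_indic d (T : measurableType d)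
    (mu : {measure set T -> \bar R}) N (A : nat -> set T) :
  (forall i, measurable (A i)) ->
  \int[mu]_x (\sum_(i < N) \1_(A i) x)%R%:E = \sum_(i < N) mu (A i).
Proof.
move=> mA; under eq_integral do rewrite -sumEFin.
rewrite ge0_integral_sum//.
- by apply: eq_bigr => i _; rewrite integral_indic// setIT.
- by move=> i; apply/measurable_EFinP; exact: measurable_indic.

Qed.

(** For [k >= 1] the staircase [k^-1 * sum_(i < k^2) 1_{(i+1)/k < w}] lies within
    [1/k] of [min w k], so its integrals determine that of [w]. *)
Lemma integral_le_layers d (T : measurableType d) (P : probability T R)
    (w : T -> R) (c : R) : measurable_fun setT w -> (forall x, 0 <= w x)%R ->
  (forall k N : nat, (0 < k)%N ->
    \sum_(i < N) P [set x | i.+1%:R / k%:R < w x]%R <= (k%:R * c)%:E) ->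
  \int[P]_x (w x)%:E <= c%:E.
Proof.
move=> mw w0 Pc.
pose f k x := (Num.min (w x) k%:R)%:E : \bar R.
have mf k : measurable_fun setT (f k).
  by apply/measurable_EFinP; exact: measurable_minr.
have f0 k x : 0 <= f k x by rewrite lee_fin le_min w0 ler0n.
have f_nd x : nondecreasing_seq (f^~ x).
  by move=> m n mn; rewrite lee_fin le_min2// ler_nat.
have f_lim x : limn (f^~ x) = (w x)%:E.
  apply/cvg_lim => //; apply: (@cvg_near_cst _ _ (w x)%:E).
  near=> k; rewrite /f min_l//; near: k; exact: nbhs_infty_ger.
have := @cvg_monotone_convergence _ _ _ P _ measurableT f mf
  (fun k x _ => f0 k x) (fun x _ => @f_nd x).
under eq_integral do rewrite f_lim; move=> fw.
apply/lee_addgt0Pr => e e0; rewrite -EFinD.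
rewrite -(cvg_lim _ fw)//; apply: lime_le; first by apply/cvg_ex; eexists; exact: fw.
have mW a := measurable_superlevel a mw.
near=> k.
have k0 : (0 < k)%N by near: k; exact: nbhs_infty_gt.
have kR0 : (0 < k%:R :> R)%R by rewrite ltr0n.
pose N := (k * k)%N; pose A i := [set x | (i.+1%:R / k%:R < w x)%R].
have fA x : f k x <= (k%:R^-1 * (\sum_(i < N) \1_(A i) x + 1))%R%:E.
  rewrite lee_fin ler_pdivlMl// minr_pMr// -natrM.
  apply: le_trans (min_le_sum_lt_nat _ _) _; rewrite lerD2r.
  by apply: ler_sum => i _; rewrite indic_layer.
apply: (@le_trans _ _
    (\int[P]_x ((k%:R^-1)%:E * (\sum_(i < N) \1_(A i) x + 1)%R%:E))).
  have mS : measurable_fun setT (fun x => (\sum_(i < N) \1_(A i) x + 1)%R : R).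
    apply: measurable_funD => //.
    by apply: measurable_sum => i; apply: measurable_indic; exact: mW.
  apply: ge0_le_integral => //.
  by apply: measurable_funeM; exact/measurable_EFinP.
have sum_ge0 x : (0 <= \sum_(i < N) \1_(A i) x :> R)%R by exact: sumr_ge0.
have mSum : measurable_fun setT (fun x => \sum_(i < N) \1_(A i) x : R)%R.
  by apply: measurable_sum => i; apply: measurable_indic; exact: mW.
rewrite ge0_integralZl_EFin//; first last.
- by apply/measurable_EFinP; exact: measurable_funD.
- by move=> x _; rewrite lee_fin addr_ge0.
under eq_integral do rewrite EFinD.
rewrite ge0_integralD//; [|by move=> x _; rewrite lee_fin|exact/measurable_EFinP].
rewrite integral_sum_indic => [|i]; last exact: mW.
rewrite integral_cst// [X in 1 * X](_ : _ = 1); last exact: probability_setT.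
rewrite mule1 lee_pdivrMl//.
apply: (le_trans (leeD2r _ (Pc k N k0))).
rewrite -EFinM -EFinD lee_fin mulrDr lerD2l.
rewrite -ler_pdivrMr// div1r; near: k; exact: nbhs_infty_ger.
Unshelve. all: by end_near. Qed.
End LayerCake.

(** * Borel probabilities on Polish spaces *)

Section MetrizableSpace.
Local Open Scope ring_scope.
Context {R : realType} {T : ptopologicalType} {d : T -> T -> R}.
Context (dm : is_metric d) (dT : metric_compatible d).

Let d0 x y : 0 <= d x y. Proof. by have [] := dm. Qed.
Let dxx x : d x x = 0. Proof. by have [_ /(_ x x)[_ ->]] := dm. Qed.
Let dC x y : d x y = d y x. Proof. by have [_ _ ->] := dm. Qed.
Let dD x y z : d x z <= d x y + d y z. Proof. by have [_ _ _] := dm. Qed.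

Lemma metric_nbhsP x (A : set T) :
  nbhs x A <-> exists2 e, 0 < e & [set z | d x z < e] `<=` A.
Proof. by rewrite dT; split=> [[e /= e0 eA]|[e e0 eA]]; exists e. Qed.

Lemma metric_ball_nbhs x e : 0 < e -> nbhs x [set z | d x z < e].
Proof. by move=> e0; apply/metric_nbhsP; exists e. Qed.

Lemma metric_openP (A : set T) :
  (forall x, A x -> exists2 e, 0 < e & [set z | d x z < e] `<=` A) -> open A.
Proof. by move=> h; rewrite openE => x /h /metric_nbhsP. Qed.

Lemma metric_closed_ball_closed x e : closed [set z | d x z <= e].
Proof.
rewrite -[X in closed X]setCK; apply: open_closedC; apply: metric_openP => y /=.
move=> /negP; rewrite -ltNge => ey; exists (d x y - e); first by rewrite subr_gt0.
move=> z /= yz; apply/negP; rewrite -ltNge.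
by have := dD x z y; rewrite (dC z y); lra.
Qed.

Lemma metric_hausdorff : hausdorff_space T.
Proof.
move=> p q pq; have [_ /(_ p q)[pq0 _] _ _] := dm; apply: pq0.
apply/eqP; rewrite eq_le d0 andbT; apply/ler_addgt0Pr => e e0; rewrite add0r.
have e20 : 0 < e / 2 by rewrite divr_gt0.
have [z [/= pz qz]] := pq _ _ (metric_ball_nbhs p e20) (metric_ball_nbhs q e20).
by have := dD p z q; rewrite (dC z q); lra.
Qed.

Lemma metric_open_Fsigma (U : set T) : open U -> exists F : (set T)^nat,
  [/\ forall k, closed (F k), nondecreasing_seq F & \bigcup_k F k = U].
Proof.
(* [F k] is the set of points at distance at least [1 / (k + 1)] from [~` U]. *)
move=> oU; pose F (k : nat) := [set x | [set z | d x z < k.+1%:R^-1] `<=` U].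
exists F; split => [k|m n mn|].
- rewrite -[X in closed X]setCK; apply: open_closedC; apply: metric_openP => x.
  move=> /existsNP[y /not_implyP[/= xy Uy]].
  exists (k.+1%:R^-1 - d x y); first by rewrite subr_gt0.
  move=> z /= xz; apply/existsNP; exists y; apply/not_implyP; split => //=.
  apply: le_lt_trans (dD z x y) _; rewrite (dC z x).
  by rewrite -ltrBrDr.
- apply/subsetPset => x Fx z /= xz; apply: Fx; apply: lt_le_trans xz _.
  by rewrite lef_pV2 ?posrE// ler_nat.
- apply/seteqP; split => [x [k _ Fx]|x Ux]; first by apply: Fx; rewrite /= dxx.
  have /metric_nbhsP[e e0 eU] : nbhs x U by exact: open_nbhs_nbhs.
  have [k ke] : exists k, k.+1%:R^-1 < e.
    have [N _ /(_ N (leqnn N)) Ne] := near_infty_natSinv_lt (PosNum e0).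
    by exists N.
  by exists k => // z /= xz; apply: eU; exact: lt_trans ke.
Qed.

End MetrizableSpace.

Section BorelProbabilities.
Context {R : realType} {T : ptopologicalType}.
Local Open Scope ereal_scope.

Lemma open_borel (U : set T) : open U -> measurable (U : set (borel T)).
Proof. by move=> oU; apply: sub_sigma_algebra. Qed.

Lemma closed_borel (F : set T) : closed F -> measurable (F : set (borel T)).
Proof.
move=> cF; rewrite -[F]setCK; apply: (@measurableC _ (borel T)); apply: open_borel.
exact: closed_openC.
Qed.

(** Domination on open sets is domination in the other direction on closed sets;
    writing an open set as an increasing union of closed ones turns it back, so
    that both measures agree on the open sets, a generating pi-system. *)
Lemma borel_probability_eq (P Q : probability (borel T) R) :
  (forall U : set T, open U -> exists F : (set T)^nat,
    [/\ forall k, closed (F k), nondecreasing_seq F & \bigcup_k F k = U]) ->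
  (forall U : set T, open U -> P U <= Q U) ->
  forall A : set (borel T), measurable A -> P A = Q A.
Proof.
move=> Fsigma PQ.
have QP (F : set T) : closed F -> Q F <= P F.
  move=> cF; have mF := closed_borel cF.
  have := PQ _ (closed_openC cF).
  rewrite !(@probability_setC _ (borel T))//.
  rewrite -(fineK (fin_num_measure P F mF)) -(fineK (fin_num_measure Q F mF)).
  by rewrite -!EFinB !lee_fin; lra.
have PQopen (U : set T) : open U -> P U = Q U.
  move=> oU; apply/eqP; rewrite eq_le PQ//=.
  have [G [cG ndG GU]] := Fsigma U oU.
  have mG k : measurable (G k : set (borel T)) by exact: closed_borel.
  have mGU : measurable (\bigcup_k G k : set (borel T)).
    by rewrite GU; exact: open_borel.
  have cvP := @nondecreasing_cvg_mu _ (borel T) _ P G mG mGU ndG.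
  have cvQ := @nondecreasing_cvg_mu _ (borel T) _ Q G mG mGU ndG.
  rewrite -GU -(cvg_lim _ cvP)// -(cvg_lim _ cvQ)//; apply: lee_lim.
  - by apply/cvg_ex; eexists; exact: cvQ.
  - by apply/cvg_ex; eexists; exact: cvP.
  - by apply: nearW => k; exact: QP.
apply: (@g_sigma_algebra_measure_unique _ _ (borel T) (@open T) _ (fun=> setT)).
- exact: open_borel.
- by move=> _; exact: openT.
- by rewrite bigcup_const.
- exact: openI.
- exact: PQopen.
- by move=> _; rewrite [X in X < _](_ : _ = 1) ?ltry//; exact: probability_setT.
Qed.

End BorelProbabilities.

Section UlamTightness.
Local Open Scope ereal_scope.
Context {R : realType} {T : ptopologicalType}.
Context (T_polish : polish_space R T).

(** An ultrafilter containing [K] contains, for every [k], one of the finitely many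
    closed balls of radius [1 / (k + 1)] that cover [K]; points in the successive
    intersections of these balls form a Cauchy sequence, and the ultrafilter
    converges to its limit. *)
Lemma totally_bounded_compact (d : T -> T -> R) (K : set T) :
  is_metric d -> metric_compatible d -> metric_complete d -> closed K ->
  (forall k : nat, exists s : seq T,
    K `<=` \bigcup_(x in [set` s]) [set z | (d x z <= k.+1%:R^-1)%R]) ->
  compact K.
Proof.
move=> dm dT dcomp cK Kcov; have [d0 dE dC dD] := dm.
rewrite compact_ultra => F UF FK.
pose B x k := [set z | (d x z <= k.+1%:R^-1)%R].
have FB k : exists x, F (B x k).
  have [s Ks] := Kcov k.
  have : F (\bigcup_(x in [set` s]) B x k) by exact: filterS FK.
  elim: s {Ks} => [|x s ih].
    rewrite (_ : [set` _] = set0) ?bigcup_set0; last by apply/seteqP; split.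
    by move=> F0; case: (@filter_not_empty _ F _).
  rewrite (_ : [set` x :: s] = [set x] `|` [set` s]); last first.
    apply/seteqP; split => y /=; rewrite in_cons.
      by move=> /orP[/eqP ->|]; [left|right].
    by move=> [->|->]; rewrite ?eqxx ?orbT.
  rewrite bigcup_setU bigcup_set1 => FU.
  have [FBx|FnB] := in_ultra_setVsetC (B x k) UF; first by exists x.
  apply: ih; apply: filterS (filterI FU FnB) => z [[Bxz|//] nBxz].
  by case: (nBxz Bxz).
have [x xB] := choice FB.
have /choice[u uB] : forall n, exists y, forall k, (k <= n)%N -> B (x k) k y.
  move=> n.
  suff : F [set y | forall k, (k <= n)%N -> B (x k) k y] by exact: filter_ex.
  elim: n => [|n ih].
    by apply: filterS (xB 0%N) => y By k; rewrite leqn0 => /eqP ->.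
  apply: filterS (filterI ih (xB n.+1)) => y [By Byn] k.
  by rewrite leq_eqVlt => /orP[/eqP ->//|]; rewrite ltnS; exact: By.
have small e : (0 < e)%R -> exists k : nat, (k.+1%:R^-1 + k.+1%:R^-1 < e :> R)%R.
  move=> e0; have e20 : (0 < e / 2)%R by rewrite divr_gt0.
  have [N _ /(_ N (leqnn N)) /= Ne] := near_infty_natSinv_lt (PosNum e20).
  by exists N; rewrite [ltRHS]splitr ltrD.
have near2 k y z : B (x k) k y -> B (x k) k z ->
    (d y z <= k.+1%:R^-1 + k.+1%:R^-1)%R.
  move=> /= xy xz; apply: le_trans (dD y (x k) z) _; rewrite (dC y).
  exact: lerD.
have [l ul] : exists l : T, u @ \oo --> l.
  apply: dcomp => e /small[k ke]; exists k => m n km kn.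
  by apply: le_lt_trans ke; apply: near2; exact: uB.
have lB k : B (x k) k l.
  have cB : closed (B (x k) k) by exact: metric_closed_ball_closed.
  apply: (closed_cvg _ cB _ _ ul); exists k => // n /= kn; exact: uB.
have Fl : F --> l.
  move=> A /(metric_nbhsP dT)[e /small[k ke] eA].
  apply: filterS (xB k) => y By; apply: eA => /=.
  by apply: le_lt_trans ke; exact: near2.
exists l; split => //; apply: cK => A lA.
by have := filter_ex (filterI (Fl _ lA) FK) => -[y [Ay Ky]]; exists y; split.
Qed.
(** For each [k], finitely many balls of radius [1 / (k + 1)] around a dense sequence
    miss a set of measure at most [e / 2 ^ (k + 1)]; intersecting over [k] gives a
    totally bounded closed set. *)
Lemma ulam_tight (P : probability (borel T) R) (e : R) : (0 < e)%R ->
  exists2 K : set T, compact K & P (~` K) <= e%:E.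
Proof.
move=> e0; have [[D cD dD] [d [dm dT dcomp]]] := T_polish.
have [_ _ dC _] := dm.
have [f Df] := pcard_surjP cD.
pose B k x := [set z | (d x z <= k.+1%:R^-1)%R].
pose A k n := \bigcup_(i in [set i | (i < n)%N]) B k (f i).
have cA k n : closed (A k n).
  by apply: closed_bigcup => // i _; exact: metric_closed_ball_closed.
have mA k n : measurable (A k n : set (borel T)) by exact: closed_borel.
have UA k : \bigcup_n A k n = setT.
  apply/seteqP; split => // x _.
  have k0 : (0 < k.+1%:R^-1 :> R)%R by rewrite invr_gt0.
  pose O := [set z | (d x z < k.+1%:R^-1)%R].
  have oO : open O.
    apply: (metric_openP dT) => y /= xy; exists (k.+1%:R^-1 - d x y)%R; first by rewrite subr_gt0.
    move=> z /= yz; have [_ _ _ dD'] := dm.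
    by apply: le_lt_trans (dD' x y z) _; rewrite addrC -ltrBrDr.
  have [y [/= xy Dy]] : (O `&` D) !=set0.
    by apply: dD => //; exists x; rewrite /O /=; have [_ /(_ x x)[_ ->]] := dm.
  have [i _ fiy] := Df _ Dy.
  by exists i.+1 => //; exists i => //=; rewrite /B /= fiy dC ltW.
have ndA k : nondecreasing_seq (A k).
  move=> m n mn; apply/subsetPset => x [i /= im Bx]; exists i => //=.
  exact: leq_trans mn.
have en0 k : (0 < e / (2 ^ k.+1)%:R)%R by rewrite divr_gt0// ltr0n expn_gt0.
have /choice[N NP] k : exists n, P (~` A k n) <= (e / (2 ^ k.+1)%:R)%:E.
  apply: contrapT => /forallNP noN.
  have mA' n : measurable (~` A k n : set (borel T)).
    exact: (@measurableC _ (borel T)).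
  have A0 : \bigcap_n ~` A k n = set0 by rewrite -setC_bigcup UA setCT.
  have P0 : P \o (fun n => ~` A k n) @ \oo --> 0.
    rewrite -(measure0 P) -A0.
    apply: (@nonincreasing_cvg_mu _ (borel T) _ P (fun n => ~` A k n)) => //.
    - by rewrite -ge0_fin_numE//; exact: fin_num_measure.
    - by rewrite A0; exact: (@measurable0 _ (borel T)).
    - move=> m n mn; apply/subsetPset; apply: subsetC; apply/subsetPset.
      exact: ndA.
  have : (e / (2 ^ k.+1)%:R)%:E <= limn (P \o (fun n => ~` A k n)).
    apply: lime_ge; first by apply/cvg_ex; eexists; exact: P0.
    by apply: nearW => n; have /negP := noN n; rewrite -ltNge => /ltW.
  by rewrite (cvg_lim _ P0)// lee_fin leNgt en0.
pose K := \bigcap_k A k (N k).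
have cK : closed K by apply: closed_bigI => k _; exact: cA.
exists K.
  apply: (totally_bounded_compact dm dT dcomp cK) => k.
  exists (map f (iota 0 (N k))) => x /(_ k Logic.I)[i /= iN Bx].
  by exists (f i) => //=; apply: map_f; rewrite mem_iota.
apply: le_trans (epsilon_trick0 xpredT (ltW e0)).
apply: (@le_trans _ _ (\sum_(k <oo) P (~` A k (N k)))); last first.
  by apply: lee_nneseries => k *; [exact: measure_ge0|exact: NP].
apply: (@measure_sigma_subadditive _ _ (borel T)).
- by move=> k; apply: (@measurableC _ (borel T)).
- by apply: (@measurableC _ (borel T)); exact: closed_borel.
- by rewrite /K setC_bigcap.
Qed.

Lemma polish_hausdorff : hausdorff_space T.
Proof. by have [_ [d [dm dT _]]] := T_polish; exact: metric_hausdorff dm dT. Qed.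

Lemma polish_open_Fsigma (U : set T) : open U -> exists F : (set T)^nat,
  [/\ forall k, closed (F k), nondecreasing_seq F & \bigcup_k F k = U].
Proof. by have [_ [d [dm dT _]]] := T_polish; exact: metric_open_Fsigma dm dT _. Qed.

(** The measure generated by the compact content [K |-> P K] is outer regular by
    construction and coincides with [P]. *)
Lemma borel_inner_regular (P : probability (borel T) R) (A : set (borel T))
    (e : R) : (0 < e)%R -> measurable A ->
  exists F : set T, [/\ closed F, F `<=` A & P A <= P F + e%:E].
Proof.
move=> e0 mA; have hT := polish_hausdorff.
have Pfin (B : set (borel T)) : measurable B -> P B \is a fin_num.
  by move=> mB; exact: fin_num_measure.
have mK (K : set T) : compact K -> measurable (K : set (borel T)).
  by move=> cK; apply: closed_borel; exact: compact_closed.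
pose lam (K : set T) := fine (P K).
have lamC : compact_content lam.
  split=> [K cK|K L cK cL KL|K L cK cL|K L cK cL KL0].
  - by rewrite fine_ge0.
  - apply: fine_le; [exact: Pfin (mK _ cK)|exact: Pfin (mK _ cL)|].
    by apply: (@le_measure _ _ (borel T)) => //; rewrite inE; exact: mK.
  - rewrite -fineD; [|exact: Pfin (mK _ cK)|exact: Pfin (mK _ cL)].
    apply: fine_le; [exact: Pfin (mK _ (compactU cK cL))| |].
      by rewrite fin_numD !Pfin//; exact: mK.
    by apply: (@measureU2 _ (borel T)); exact: mK.
  - rewrite -fineD; [|exact: Pfin (mK _ cK)|exact: Pfin (mK _ cL)].
    by rewrite -(@measureU _ _ (borel T))//; exact: mK.
have lam1 K : compact K -> (lam K <= 1)%R.
  move=> cK; rewrite -lee_fin /lam fineK; last exact: Pfin (mK _ cK).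
  by apply: probability_le1; exact: mK.
have lam_tight r : (0 < r)%R -> exists2 K, compact K & (1 - r <= lam K)%R.
  move=> r0; have [K cK Kr] := ulam_tight P r0; exists K => //.
  move: Kr; rewrite (@probability_setC _ (borel T)); last exact: mK.
  rewrite -lee_fin /lam; have := Pfin _ (mK _ cK); case: (P K) => // p _.
  by rewrite -!EFinB !lee_fin /=; lra.
have [mu [mu_open mu_reg]] := content_measure_exists hT lamC lam1 lam_tight.
have muP (U : set T) : open U -> mu U <= P U.
  move=> oU; have mU : measurable (U : set (borel T)) by exact: open_borel.
  rewrite -(fineK (Pfin _ mU)); apply: mu_open => // K cK KU.
  apply: fine_le; [exact: Pfin (mK _ cK)|exact: Pfin|].
  by apply: (@le_measure _ _ (borel T)) => //; rewrite inE//; exact: mK.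
have {}muP := borel_probability_eq polish_open_Fsigma muP.
have mA' : measurable (~` A) by exact: measurableC.
have [U [oU AU Ue]] := mu_reg (~` A) e e0.
exists (~` U); split; first exact: open_closedC.
  by rewrite -[A]setCK; exact: subsetC.
have mU : measurable (U : set (borel T)) by exact: open_borel.
move: Ue; rewrite !muP// !(@probability_setC _ (borel T))//.
rewrite -(fineK (Pfin _ mU)) -(fineK (Pfin _ mA)).
by rewrite -!EFinB -!EFinD !lee_fin; lra.
Qed.

End UlamTightness.

(** * Upper semicontinuous functions *)

Section UpperSemicontinuity.
Local Open Scope ring_scope.
Context {R : realType} {T : topologicalType}.
Implicit Types f g : T -> R.

Lemma usc_cst (c : R) : upper_semicontinuous (fun _ : T => c).
Proof. by move=> x a ca; apply: nearW. Qed.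

Lemma usc_add f g : upper_semicontinuous f -> upper_semicontinuous g ->
  upper_semicontinuous (fun x => f x + g x).
Proof.
move=> uf ug x a fga; pose r := (a - f x - g x) / 2.
have r0 : 0 < r by rewrite /r; lra.
have fr : f x < f x + r by rewrite ltrDl.
have gr : g x < g x + r by rewrite ltrDl.
apply: filterS2 (uf _ _ fr) (ug _ _ gr) => y fy gy.
by apply: lt_le_trans (ltrD fy gy) _; rewrite /r; lra.
Qed.

Lemma usc_sum (I : Type) (s : seq I) (f : I -> T -> R) :
  (forall i, upper_semicontinuous (f i)) ->
  upper_semicontinuous (fun x => \sum_(i <- s) f i x).
Proof.
move=> uf; elim: s => [|i s ih].
  by under eq_fun do rewrite big_nil; exact: usc_cst.
by under eq_fun do rewrite big_cons; exact: usc_add.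
Qed.

Lemma usc_scale (c : R) f : 0 <= c -> upper_semicontinuous f ->
  upper_semicontinuous (fun x => c * f x).
Proof.
rewrite le_eqVlt => /orP[/eqP <- _|c0 uf x a].
  by under eq_fun do rewrite mul0r; exact: usc_cst.
rewrite mulrC -ltr_pdivlMr// => /uf; apply: filterS => y.
by rewrite ltr_pdivlMr// mulrC.
Qed.

Lemma usc_indic_closed (F : set T) : closed F ->
  upper_semicontinuous (fun x => \1_F x : R).
Proof.
move=> cF x a; rewrite indicE; have [xF|xF] := boolP (x \in F) => /= xa.
  apply: nearW => y; apply: le_lt_trans xa.
  by rewrite indicE ler_nat leq_b1.
have : nbhs x (~` F).
  apply: open_nbhs_nbhs; split; first exact: closed_openC.
  by move=> Fx; rewrite mem_set in xF.
by apply: filterS => y Fy; rewrite indicE memNset.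
Qed.

Lemma usc_comp (U : topologicalType) (h : U -> T) f : continuous h ->
  upper_semicontinuous f -> upper_semicontinuous (f \o h).
Proof. by move=> ch uf x a /uf /(ch x). Qed.

Lemma continuous_usc f : continuous f -> upper_semicontinuous f.
Proof.
move=> cf x a fa; have : nbhs (f x) [set r | r < a].
  by apply: open_nbhs_nbhs; split => //; exact: open_lt.
by move=> /(cf x).
Qed.

Lemma usc_superlevelN_open f (a : R) : upper_semicontinuous f ->
  open [set x | a < - f x].
Proof.
move=> uf; rewrite openE => x /=; rewrite ltrNr => /uf.
by apply: filterS => y /=; rewrite ltrNr.
Qed.

End UpperSemicontinuity.

Section UscMinorants.
Local Open Scope ereal_scope.
Context {R : realType} {T : ptopologicalType}.

Lemma continuous_borel (U : ptopologicalType) (h : T -> U) : continuous h ->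
  measurable_fun [set: borel T] (h : borel T -> borel U).
Proof.
move=> ch; apply: (@measurability _ _ (borel T) (borel U) setT h (@open U)) => //.
move=> _ [V oV <-]; rewrite setTI; apply: open_borel.
by move/continuousP : ch; exact.
Qed.

Lemma continuous_borelR (f : T -> R) : continuous f ->
  measurable_fun [set: borel T] (f : borel T -> R).
Proof.
move=> cf; apply: (measurability _ (RGenOInfty.measurableE R)).
move=> _ [_ [a ->] <-]; rewrite setTI; apply: open_borel.
by move/continuousP : cf; apply; exact: rray_open.
Qed.

Definition usc_minorant (g u : T -> R) := [/\
  measurable_fun [set: borel T] (u : borel T -> R), upper_semicontinuous u,
  (exists M : R, forall x, (u x <= M)%R) & forall x, (0 <= u x <= g x)%R].

(** Each superlevel set of the staircase below [g] is replaced by a closed subset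
    of nearly the same measure. *)
Lemma integral_le_usc_minorants (P : probability (borel T) R)
    (g : T -> R) (c : R) : polish_space R T ->
  measurable_fun [set: borel T] (g : borel T -> R) -> (forall x, 0 <= g x)%R ->
  (forall u, usc_minorant g u -> \int[P]_x (u x)%:E <= c%:E) ->
  \int[P]_x (g x)%:E <= c%:E.
Proof.
move=> T_polish mg g0 uc; apply: integral_le_layers => // k N k0.
pose A i := [set x | i.+1%:R / k%:R < g x]%R.
have mA i : measurable (A i : set (borel T)) by exact: measurable_superlevel.
apply/lee_addgt0Pr => e e0.
have eN0 : (0 < e / N.+1%:R)%R by rewrite divr_gt0.
have /choice[F FP] i := borel_inner_regular T_polish P eN0 (mA i).
have mF i : measurable (F i : set (borel T)).
  by apply: closed_borel; have [] := FP i.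
have kR0 : (0 < k%:R :> R)%R by rewrite ltr0n.
pose u x : R := (k%:R^-1 * \sum_(i < N) \1_(F i) x)%R.
have mS : measurable_fun [set: borel T]
    ((fun x => \sum_(i < N) \1_(F i) x : R)%R : borel T -> R).
  by apply: measurable_sum => i; exact: measurable_indic.
have S0 x : (0 <= \sum_(i < N) \1_(F i) x :> R)%R by exact: sumr_ge0.
have : \int[P]_x (u x)%:E <= c%:E.
  apply: uc; split.
  - exact: measurable_funM.
  - apply: usc_scale; first by rewrite invr_ge0 ltW.
    by apply: usc_sum => i; apply: usc_indic_closed; have [] := FP i.
  - exists (k%:R^-1 * N%:R)%R => x; rewrite ler_pM2l ?invr_gt0//.
    rewrite -[in leRHS](card_ord N) -sumr_const; apply: ler_sum => i _.
    by rewrite indicE lern1 leq_b1.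
  - move=> x; rewrite mulr_ge0 ?invr_ge0 ?(ltW kR0)//= ler_pdivrMl//.
    apply: le_trans (sum_layers_le N k0 (g0 x)); apply: ler_sum => i _.
    rewrite !indicE ler_nat; have [_ FA _] := FP i.
    have [xF|//] := boolP (x \in F i).
    by rewrite mem_set//; apply: FA; exact: set_mem.
under eq_integral do rewrite EFinM.
rewrite ge0_integralZl_EFin//; first last.
- exact/measurable_EFinP.
- by move=> x _; rewrite lee_fin.
rewrite (@integral_sum_indic _ _ (borel T))// lee_pdivrMl// => PF.
apply: (@le_trans _ _ (\sum_(i < N) (P (F i) + (e / N.+1%:R)%:E))).
  by apply: lee_sum => i _; have [] := FP i.
rewrite big_split/= EFinM; apply: leeD => //.
rewrite sumEFin lee_fin sumr_const card_ord -[leLHS]mulr_natr.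
by rewrite mulrAC ler_pdivrMr// ler_pM2l// ler_nat.
Qed.

End UscMinorants.

(** * Functions dominated by sums of functions of one coordinate *)

Section CountableSums.
Local Open Scope ring_scope.
Local Open Scope ereal_scope.
Context {R : realType} {I : countType}.
Implicit Types a : I -> \bar R.

(** Turns the supremum of finite sums into a series, to which the monotone
    convergence theorem applies. *)
Lemma esum_countE a : (forall i, 0 <= a i) ->
  \esum_(i in [set: I]) a i = \sum_(k <oo) oapp a 0 (pickle_inv k).
Proof.
move=> a0; pose b k := oapp a 0 (@pickle_inv I k).
have b0 k : 0 <= b k by rewrite /b; case: pickle_inv => //=.
rewrite nneseries_esumT//.
transitivity (\esum_(k in choice.pickle @` [set: I]) b k).
  rewrite esum_image; last by move=> i j _ _ /(pcan_inj (@pickleK_inv I)).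
  by apply: eq_esum => i _; rewrite /b pickleK_inv.
rewrite esum_mkcond; apply: eq_esum => k _; case: ifPn => // /negP.
rewrite inE /b; have := @pickle_invK I k; case: pickle_inv => //= i ik [].
by exists i.
Qed.

Lemma esum_ge_term a i : a i <= \esum_(i in [set: I]) a i.
Proof.
apply: esum_ge; exists [set i]; last by rewrite fsbig_set1.
by split => //; exact: finite_set1.
Qed.

Lemma esumZ (t : R) a : (0 <= t)%R -> (forall i, 0 <= a i) ->
  \esum_(i in [set: I]) (t%:E * a i) = t%:E * \esum_(i in [set: I]) a i.
Proof.
move=> t0 a0; rewrite !esum_countE// => [|i]; last by rewrite mule_ge0.
rewrite -nneseriesZl => [|k _]; last by case: pickle_inv => //=.
by apply: eq_eseriesr => k _; case: pickle_inv => //=; rewrite mule0.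
Qed.

Lemma countable_weights (e : R) : (0 < e)%R -> exists w : I -> R,
  (forall i, 0 < w i)%R /\ \esum_(i in [set: I]) (w i)%:E <= e%:E.
Proof.
move=> e0; exists (fun i => e / (2 ^ (choice.pickle i).+1)%:R)%R; split => [i|].
  by rewrite divr_gt0// ltr0n expn_gt0.
rewrite esum_countE => [|i]; last by rewrite lee_fin divr_ge0// ltW.
apply: le_trans (epsilon_trick0 xpredT (ltW e0)).
apply: lee_nneseries => k *.
  by case: pickle_inv => //= i; rewrite lee_fin divr_ge0// ltW.
have := @pickle_invK I k; case: pickle_inv => //= [i ->//|_].
by rewrite lee_fin divr_ge0// ltW.
Qed.

End CountableSums.

(** The product space together with its base point, in the form required by the
    results above on pointed topological spaces. *)
Definition product_space (I : Type) (X : I -> ptopologicalType) :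
    ptopologicalType :=
  HB.pack (prod_topology X) (isPointed.Build (prod_topology X) point).

Section MarginalSpaces.
Local Open Scope ring_scope.
Local Open Scope ereal_scope.
Context {R : realType} {I : countType} {X : I -> ptopologicalType}.
Context {nu : forall n, probability (borel (X n)) R}.
Local Notation PX := (prod_topology X).
Implicit Types (g : forall n, X n -> R) (f : PX -> R).

Lemma proj_borel n :
  measurable_fun [set: borel PX] (proj n : borel PX -> borel (X n)).
Proof.
exact: (@continuous_borel (product_space X) (X n) _ (@proj_continuous I X n)).
Qed.

Lemma oplus_ge0 g x : (forall n x, 0 <= g n x)%R -> 0 <= oplus g x.
Proof. by move=> g0; apply: esum_ge0 => n _; rewrite lee_fin. Qed.

Lemma oplus_ge_term g n x : (g n (proj n x))%:E <= oplus g x.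
Proof. exact: (@esum_ge_term _ _ (fun n => (g n (proj n x))%:E)). Qed.

Lemma oplusD g h x : (forall n x, 0 <= g n x)%R -> (forall n x, 0 <= h n x)%R ->
  oplus (fun n y => g n y + h n y)%R x = oplus g x + oplus h x.
Proof.
by move=> g0 h0; rewrite -esumD// => n _; rewrite lee_fin.
Qed.

Lemma oplusZ (t : R) g x : (0 <= t)%R -> (forall n x, 0 <= g n x)%R ->
  oplus (fun n y => t * g n y)%R x = t%:E * oplus g x.
Proof. by move=> t0 g0; rewrite -esumZ// => n; rewrite lee_fin. Qed.

Lemma pairing_ge0 g n : (forall n x, 0 <= g n x)%R ->
  0 <= pairing (g n : borel (X n) -> R) (nu n).
Proof. by move=> g0; apply: integral_ge0 => x _; rewrite lee_fin. Qed.

Lemma sum_pairing_ge0 g : (forall n x, 0 <= g n x)%R -> 0 <= sum_pairing nu g.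
Proof. by move=> g0; apply: esum_ge0 => n _; exact: pairing_ge0. Qed.

Lemma sum_pairingD g h : (forall n, nonneg_borel_functions (g n)) ->
  (forall n, nonneg_borel_functions (h n)) ->
  sum_pairing nu (fun n y => g n y + h n y)%R =
  sum_pairing nu g + sum_pairing nu h.
Proof.
move=> gB hB; have g0 n x := (gB n).2 x; have h0 n x := (hB n).2 x.
rewrite -esumD; [|by move=> n _; exact: pairing_ge0..].
apply: eq_esum => n _; rewrite /pairing; under eq_integral do rewrite EFinD.
rewrite ge0_integralD//.
- by move=> x _; rewrite lee_fin.
- by apply/measurable_EFinP; exact: (gB n).1.
- by move=> x _; rewrite lee_fin.
- by apply/measurable_EFinP; exact: (hB n).1.
Qed.

Lemma sum_pairingZ (t : R) g : (0 <= t)%R ->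
  (forall n, nonneg_borel_functions (g n)) ->
  sum_pairing nu (fun n y => t * g n y)%R = t%:E * sum_pairing nu g.
Proof.
move=> t0 gB; have g0 n x := (gB n).2 x.
rewrite -esumZ//; last by move=> n; exact: pairing_ge0.
apply: eq_esum => n _; rewrite /pairing; under eq_integral do rewrite EFinM.
rewrite ge0_integralZl_EFin//.
- by move=> x _; rewrite lee_fin.
- by apply/measurable_EFinP; exact: (gB n).1.
Qed.

Lemma GseqD g h : Gseq nu g -> Gseq nu h ->
  Gseq nu (fun n y => g n y + h n y)%R.
Proof.
move=> [gB gS] [hB hS]; split; last by rewrite sum_pairingD// lte_add_pinfty.
move=> n; have [mg g0] := gB n; have [mh h0] := hB n.
by split => [|x]; [exact: measurable_funD|rewrite addr_ge0].
Qed.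

Lemma GseqZ (t : R) g : (0 <= t)%R -> Gseq nu g ->
  Gseq nu (fun n y => t * g n y)%R.
Proof.
move=> t0 [gB gS]; split; last first.
  by rewrite sum_pairingZ// lte_mul_pinfty.
move=> n; have [mg g0] := gB n.
by split => [|x]; [exact: measurable_funM|rewrite mulr_ge0].
Qed.

Lemma sum_pairing_fin g : Gseq nu g -> sum_pairing nu g \is a fin_num.
Proof.
move=> [gB gS]; rewrite ge0_fin_numE// sum_pairing_ge0// => n x.
exact: (gB n).2.
Qed.

(** The family that is the indicator of [V] at the index [n] and vanishes at the
    other indices: the test functions that control the marginals. *)
Definition slice n (V : set (X n)) : forall m, X m -> R :=
  fun m x => \1_(dfwith (fun m => set0 : set (X m)) n V m) x.
Arguments slice : clear implicits.

Lemma slice_ge n (V : set (X n)) x :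
  (\1_V (proj n x : X n))%:E <= oplus (slice n V) x.
Proof.
apply: le_trans (oplus_ge_term (slice n V) n x).
by rewrite /slice dfwithin.
Qed.

Lemma sum_pairing_slice n (V : set (X n)) : measurable (V : set (borel (X n))) ->
  sum_pairing nu (slice n V) = nu n V.
Proof.
move=> mV.
have E m : pairing (slice n V m : borel (X m) -> R) (nu m) =
    if m \in [set n] then nu n V else 0.
  rewrite /slice /pairing; have [->|mn] := eqVneq m n.
    by rewrite mem_set// dfwithin integral_indic ?setIT.
  rewrite dfwithout 1?eq_sym// memNset; last by move=> /= /eqP; rewrite (negbTE mn).
  by under eq_integral do rewrite indic0; rewrite integral0.
rewrite /sum_pairing; under eq_esum do rewrite E.
by rewrite -esum_mkcond esum_set1.
Qed.

Lemma slice_Gseq n (V : set (X n)) : measurable (V : set (borel (X n))) ->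
  Gseq nu (slice n V).
Proof.
move=> mV; split.
  move=> m; split => // ; rewrite /slice; have [mn|mn] := eqVneq m n.
    by subst m; rewrite dfwithin; exact: measurable_indic.
  by rewrite dfwithout 1?eq_sym//; exact: measurable_indic.
rewrite sum_pairing_slice//.
by apply: le_lt_trans (probability_le1 _ _) (ltry _).
Qed.

Lemma oplus_measurable g : (forall n, nonneg_borel_functions (g n)) ->
  measurable_fun [set: borel PX] (oplus g : borel PX -> \bar R).
Proof.
move=> gB; have g0 n x := (gB n).2 x.
pose F k (x : borel PX) := oapp (fun n => (g n (proj n x))%:E) 0 (@pickle_inv I k).
have mF k : measurable_fun setT (F k).
  rewrite /F; case: pickle_inv => [n|] /=; last exact: measurable_cst.
  by apply/measurable_EFinP; exact: measurableT_comp (gB n).1 (@proj_borel n).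
have F0 k x : 0 <= F k x.
  by rewrite /F; case: pickle_inv => [n|] //=; rewrite lee_fin.
apply: (emeasurable_fun_cvg (fun N x => \sum_(0 <= k < N) F k x)).
  by move=> N; apply: emeasurable_sum.
move=> x _; rewrite /oplus esum_countE => [|n]; last by rewrite lee_fin.
exact: is_cvg_nneseries.
Qed.

Lemma pairing_marginal (mu : probability (borel PX) R) g n : couplings nu mu ->
  nonneg_borel_functions (g n) ->
  \int[mu]_x (g n (proj n x))%:E = pairing (g n : borel (X n) -> R) (nu n).
Proof.
move=> mu_nu [mg g0].
have mE : measurable_fun [set: borel (X n)] (EFin \o (g n : borel (X n) -> R)).
  exact/measurable_EFinP.
have := @ge0_integral_pushforward _ _ _ _ R _ (@proj_borel n) mu _ _
  (@measurableT _ (borel (X n))) mE.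
rewrite preimage_setT => <-; last by move=> y _; rewrite lee_fin.
apply: eq_measure_integral; first exact: proj_borel.
by move=> ? A mA _; exact: mu_nu.
Qed.

Lemma integral_oplus (mu : probability (borel PX) R) g : couplings nu mu ->
  (forall n, nonneg_borel_functions (g n)) ->
  \int[mu]_x oplus g x = sum_pairing nu g.
Proof.
move=> mu_nu gB; have g0 n x := (gB n).2 x.
pose F k (x : borel PX) := oapp (fun n => (g n (proj n x))%:E) 0 (@pickle_inv I k).
transitivity (\int[mu]_x \sum_(k <oo) F k x).
  apply: eq_integral => x _.
  by rewrite /oplus esum_countE => [|n]; last by rewrite lee_fin.
rewrite integral_nneseries//.
- rewrite /sum_pairing esum_countE => [|n]; last exact: pairing_ge0.
  apply: eq_eseriesr => k _; rewrite /F; case: pickle_inv => [n|] /=.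
    exact: pairing_marginal.
  exact: integral0.
- move=> k; rewrite /F; case: pickle_inv => [n|] /=; last exact: measurable_cst.
  by apply/measurable_EFinP; exact: measurableT_comp (gB n).1 (@proj_borel n).
- by move=> k x _; rewrite /F; case: pickle_inv => [n|] //=; rewrite lee_fin.
Qed.

Lemma B_nuP f : B_nu nu f <->
  borel_functions f /\ exists2 g, Gseq nu g & forall x, `|f x|%:E <= oplus g x.
Proof.
split=> [[mf [_ [g Gg <-] fg]]|[mf [g Gg fg]]]; split => //; first by exists g.
by exists (oplus g) => //; exists g.
Qed.

Lemma B_nuD f h : B_nu nu f -> B_nu nu h -> B_nu nu (f \+ h)%R.
Proof.
move=> /B_nuP[mf [g Gg fg]] /B_nuP[mh [k Gk hk]]; apply/B_nuP; split.
  exact: measurable_funD.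
exists (fun n y => g n y + k n y)%R; first exact: GseqD.
move=> x; rewrite oplusD => [|n y|n y]; [|exact: (Gg.1 n).2|exact: (Gk.1 n).2].
apply: le_trans (leeD (fg x) (hk x)); rewrite -EFinD lee_fin; exact: ler_normD.
Qed.

Lemma B_nuZ (t : R) f : B_nu nu f -> B_nu nu (fun x => t * f x)%R.
Proof.
move=> /B_nuP[mf [g Gg fg]]; apply/B_nuP; split.
  exact: measurable_funM.
exists (fun n y => `|t| * g n y)%R; first exact: GseqZ.
move=> x; rewrite oplusZ//; last by move=> n y; exact: (Gg.1 n).2.
by rewrite normrM EFinM; apply: lee_wpmul2l.
Qed.

Lemma B_nu_le f h : borel_functions f -> B_nu nu h ->
  (forall x, `|f x| <= `|h x|)%R -> B_nu nu f.
Proof.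
move=> mf /B_nuP[_ [g Gg hg]] fh; apply/B_nuP; split => //; exists g => // x.
by apply: le_trans (hg x); rewrite lee_fin.
Qed.

Lemma B_nu_cst (c : R) (n : I) : B_nu nu (fun=> c).
Proof.
have -> : (fun=> c) = (fun x : PX => c * (fun=> 1) x)%R.
  by apply/funext => x; rewrite mulr1.
apply: B_nuZ; apply/B_nuP; split; first exact: measurable_cst.
exists (slice n [set: X n]); first exact: slice_Gseq.
move=> x; apply: le_trans (slice_ge [set: X n] x).
by rewrite lee_fin normr1 indicE mem_set.
Qed.

Lemma bounded_borel_B_nu f (M : R) (n : I) : borel_functions f ->
  (forall x, `|f x| <= M)%R -> B_nu nu f.
Proof.
move=> mf fM; apply: (B_nu_le mf (B_nu_cst M n)) => x.
by apply: le_trans (ler_norm _).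
Qed.

Lemma bounded_fun_ex (T : Type) (f : T -> R) :
  bounded_fun f -> exists M, forall x, (`|f x| <= M)%R.
Proof.
move=> [M [_ fM]]; exists (M + 1)%R => x; apply: (fM (M + 1)%R) => //.
by rewrite ltrDl.
Qed.

Lemma bounded_continuous_B_nu (n : I) f :
  bounded_continuous_functions R X f -> B_nu nu f.
Proof.
move=> [cf /bounded_fun_ex[M fM]]; apply: (bounded_borel_B_nu n (M := M)).
  exact: (@continuous_borelR _ (product_space X)).
exact: fM.
Qed.

Lemma U_nu_B_nu (n : I) f : U_nu nu f -> B_nu nu f.
Proof.
move=> [[mf uf] [mfp /bounded_fun_ex[M fM]] fN].
have fpB : B_nu nu (f^\+)%R.
  by apply: (bounded_borel_B_nu n mfp (M := M)).
have -> : f = (f^\+ \+ (fun x => -1 * f^\- x))%R.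
  by apply/funext => x /=; rewrite mulN1r -[in LHS](funrposBneg f).
exact/B_nuD/B_nuZ.
Qed.

Lemma B_nu_integrable (mu : probability (borel PX) R) f : couplings nu mu ->
  B_nu nu f -> mu.-integrable setT (EFin \o (f : borel PX -> R)).
Proof.
move=> mu_nu /B_nuP[mf [g Gg fg]]; apply/integrableP; split.
  exact/measurable_EFinP.
apply: (@le_lt_trans _ _ (\int[mu]_x oplus g x)).
  apply: ge0_le_integral => //.
  - by apply: measurableT_comp => //; exact/measurable_EFinP.
  - by apply: oplus_measurable; exact: Gg.1.
  - by move=> x _; exact: fg.
by rewrite (integral_oplus mu_nu Gg.1) Gg.2.
Qed.


End MarginalSpaces.

Arguments slice {R I X} n V m x.

Definition linear_on_B_nu (R : realType) (I : countType)
    (X : I -> ptopologicalType) (nu : forall n, probability (borel (X n)) R)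
    (L : (prod_topology X -> R) -> R) :=
  (forall f h, B_nu nu f -> B_nu nu h ->
    L (fun x => f x + h x) = L f + L h)%R /\
  (forall t f, B_nu nu f -> L (fun x => t * f x) = t * L f)%R.

(** For linear functionals this one inequality encodes positivity, normalization,
    the marginals and tightness. *)
Definition marginal_dominated (R : realType) (I : countType)
    (X : I -> ptopologicalType) (nu : forall n, probability (borel (X n)) R)
    (L : (prod_topology X -> R) -> R) :=
  forall f (m : R) g, B_nu nu f -> Gseq nu g ->
    (forall x, ((f x)%:E <= m%:E + oplus g x)%E) ->
    ((L f)%:E <= m%:E + sum_pairing nu g)%E.

(** * Couplings from dominated linear functionals *)

Section DominatedFunctionals.
Local Open Scope ring_scope.
Local Open Scope ereal_scope.
Context {R : realType} {I : countType} {X : I -> ptopologicalType}.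
Context {nu : forall n, probability (borel (X n)) R}.
Context (X_polish : forall n, polish_space R (X n)).
Local Notation PX := (prod_topology X).
Implicit Types (g : forall n, X n -> R) (f : PX -> R).

Lemma product_hausdorff : hausdorff_space PX.
Proof.
apply: (@hausdorff_product I X) => n; exact: polish_hausdorff (X_polish n).
Qed.

(** A point outside a product of compact sets has a coordinate outside its factor,
    so the complement of the product is dominated by a sum of marginal tails. *)
Lemma product_tight (e : R) : (0 < e)%R -> exists (K : set PX) g,
  [/\ compact K, Gseq nu g, sum_pairing nu g <= e%:E
    & forall x, (\1_(~` K) x)%:E <= oplus g x].
Proof.
move=> e0; have [w [w0 we]] := @countable_weights R I e e0.
pose tight n := cid2 (ulam_tight (X_polish n) (nu n) (w0 n)).
pose K n : set (X n) := s2val (tight n).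
have cK n : compact (K n) by exact: (s2valP (tight n)).
have Kw n : nu n (~` K n) <= (w n)%:E by exact: (s2valP' (tight n)).
have mK n : measurable (~` K n : set (borel (X n))).
  apply: open_borel; apply: closed_openC.
  exact: compact_closed (polish_hausdorff (X_polish n)) (cK n).
pose g n (y : X n) : R := (\1_(~` K n) y)%R.
have gS : sum_pairing nu g <= e%:E.
  apply: le_trans we; apply: le_esum => n _; rewrite /pairing /g.
  rewrite integral_indic ?setIT//; exact: Kw.
exists [set x | forall n, K n (x n)], g; split => //.
- exact: (@tychonoff I X K cK).
- split; last exact: le_lt_trans gS (ltry _).
  by move=> n; split => [|y]; [exact: measurable_indic|rewrite /g indicE].
- move=> x; rewrite indicE; have [|_] := boolP (x \in _).
    rewrite inE => /existsNP[n Kxn]; apply: le_trans (oplus_ge_term g n x).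
    by rewrite /g indicE mem_set.
  by apply: oplus_ge0 => n y; rewrite /g indicE.
Qed.

Context {L : (PX -> R) -> R} (n0 : I).
Context (L_lin : linear_on_B_nu nu L) (L_dom : marginal_dominated nu L).

Let LD f h : B_nu nu f -> B_nu nu h ->
  L (fun x => f x + h x)%R = (L f + L h)%R.
Proof. exact: L_lin.1. Qed.

Let LZ t f : B_nu nu f -> L (fun x => t * f x)%R = (t * L f)%R.
Proof. exact: L_lin.2. Qed.

Let Bcst c : B_nu nu (fun _ : PX => c).
Proof. exact: B_nu_cst. Qed.

Let LB f h : B_nu nu f -> B_nu nu h ->
  L (fun x => f x - h x)%R = (L f - L h)%R.
Proof.
move=> Bf Bh; rewrite -[in RHS]mulN1r -LZ// -LD//; last exact: B_nuZ.
by congr L; apply/funext => x; rewrite mulN1r.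
Qed.

Let L_le_cst f (m : R) : B_nu nu f -> (forall x, f x <= m)%R -> (L f <= m)%R.
Proof.
move=> Bf fm; rewrite -lee_fin.
have := L_dom (g := slice n0 set0) (m := m) Bf (slice_Gseq measurable0).
rewrite sum_pairing_slice// measure0 adde0; apply => x.
rewrite -[leLHS]adde0; apply: leeD; first by rewrite lee_fin.
by apply: oplus_ge0 => n y; rewrite /slice indicE.
Qed.

Lemma dominated_le f h : B_nu nu f -> B_nu nu h ->
  (forall x, f x <= h x)%R -> (L f <= L h)%R.
Proof.
move=> Bf Bh fh; rewrite -subr_le0 -LB//; apply: L_le_cst => [|x].
  rewrite (_ : (fun x => _) = (f \+ (fun x => -1 * h x))%R).
    by apply: B_nuD => //; exact: B_nuZ.
  by apply/funext => x /=; rewrite mulN1r.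
by rewrite subr_le0.
Qed.

Lemma dominated_cst c : L (fun=> c) = c.
Proof.
have L1 : (L (fun=> 1) <= 1)%R by exact: L_le_cst.
have LN1 : (L (fun=> -1) <= -1)%R by exact: L_le_cst.
have {LN1} : (-1 * L (fun=> 1) <= -1)%R.
  rewrite -LZ//; apply: le_trans LN1; rewrite le_eqVlt; apply/orP; left.
  by apply/eqP; congr L; apply/funext => x; rewrite mulr1.
move=> LN1; have {L1 LN1} L1 : L (fun=> 1%R) = 1%R by lra.
rewrite -[RHS]mulr1 -L1 -LZ//; congr L.
by apply/funext => x; rewrite mulr1.
Qed.

Lemma B_nu_indic (A : set PX) : measurable (A : set (borel PX)) ->
  B_nu nu (fun x => \1_A x)%R.
Proof.
move=> mA; apply: (bounded_borel_B_nu n0 (M := 1)) => [|x].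
  exact: measurable_indic.
by rewrite indicE ger0_norm// lern1 leq_b1.
Qed.

Let mcompact (K : set PX) : compact K -> measurable (K : set (borel PX)).
Proof.
move=> cK; apply: (@closed_borel (product_space X)).
exact: compact_closed product_hausdorff cK.
Qed.

Let indic_le (A B : set PX) x : A `<=` B -> (\1_A x <= \1_B x :> R)%R.
Proof.
move=> AB; rewrite !indicE; have [xA|_] := boolP (x \in A); last by rewrite ler0n.
by rewrite mem_set//; apply: AB; exact: set_mem.
Qed.

Lemma dominated_compact_content : compact_content (fun K : set PX => L (\1_K)%R).
Proof.
have BK K (cK : compact K) := B_nu_indic (mcompact cK).
split=> [K cK|K K' cK cK' KK'|K K' cK cK'|K K' cK cK' KK'0].
- rewrite -[leLHS](dominated_cst 0); apply: dominated_le => //; first exact: BK.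
- by apply: dominated_le => [||x]; [exact: BK|exact: BK|exact: indic_le].
- rewrite -LD; [|exact: BK..]; apply: dominated_le => [||x].
  + exact: BK (compactU cK cK').
  + by apply: B_nuD; exact: BK.
  + rewrite !indicE in_setU.
    by case: (x \in K); case: (x \in K'); rewrite /= ?addr0 ?add0r// lerDl ler01.
- rewrite -LD; [|exact: BK..]; apply: dominated_le => [||x].
  + by apply: B_nuD; exact: BK.
  + exact: BK (compactU cK cK').
  + rewrite !indicE in_setU; have [xK|_] := boolP (x \in K); last by rewrite add0r.
    rewrite (memNset (A := K')) ?addr0// => xK'.
    have : (K `&` K') x by split => //; exact: set_mem.
    by rewrite KK'0.
Qed.

Lemma dominated_tight (e : R) : (0 < e)%R ->
  exists2 K : set PX, compact K & (1 - e <= L (\1_K)%R)%R.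
Proof.
move=> e0; have [K [g [cK Gg ge Kg]]] := product_tight e0; exists K => //.
have mK := mcompact cK.
have mK' : measurable (~` K : set (borel PX)) by exact: measurableC.
have LK' : (L (\1_(~` K))%R <= e)%R.
  rewrite -lee_fin; apply: le_trans ge; rewrite -[leRHS]add0e.
  apply: L_dom => // [|x]; first exact: B_nu_indic.
  by rewrite add0e.
have : L (fun x => \1_K x + \1_(~` K) x)%R = 1%R.
  rewrite -[RHS](dominated_cst 1); congr L; apply/funext => x.
  by rewrite !indicE in_setC; case: (x \in K); rewrite ?addr0 ?add0r.
by rewrite LD; [|exact: B_nu_indic..] => LK; lra.
Qed.

Let L_sum N (A : nat -> set PX) :
  (forall i, measurable (A i : set (borel PX))) ->
  B_nu nu (fun x => \sum_(i < N) \1_(A i) x)%R /\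
  L (fun x => \sum_(i < N) \1_(A i) x)%R = (\sum_(i < N) L (\1_(A i)))%R.
Proof.
move=> mA; elim: N => [|N [BN LN]].
  have -> : (fun x => \sum_(i < 0) \1_(A i) x)%R = (fun=> 0%R) :> (PX -> R).
    by apply/funext => x; rewrite big_ord0.
  by rewrite big_ord0 dominated_cst; split => //; exact: Bcst.
have -> : (fun x => \sum_(i < N.+1) \1_(A i) x)%R =
    (fun x => (\sum_(i < N) \1_(A i) x) + \1_(A N) x)%R :> (PX -> R).
  by apply/funext => x; rewrite big_ord_recr.
split; first by apply: B_nuD => //; exact: B_nu_indic.
by rewrite LD//; [rewrite LN big_ord_recr|exact: B_nu_indic].
Qed.

(** The coupling is the measure generated by the content [K |-> L 1_K]. On open
    sets it lies below [L], so it lies above [L] on upper semicontinuous functions;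
    for preimages of open sets under a coordinate map this already bounds its
    marginal by [nu n], and a one-sided bound between probabilities on all open
    sets is an equality. *)
Lemma dominated_functional_coupling : exists mu, couplings nu mu /\
  forall f, B_nu nu f -> upper_semicontinuous f ->
    (exists M : R, forall x, f x <= M)%R ->
    (L f)%:E <= pairing (f : borel PX -> R) mu.
Proof.
have L1 (K : set PX) : compact K -> (L (\1_K)%R <= 1)%R.
  move=> cK; apply: L_le_cst; first exact: B_nu_indic (mcompact cK).
  by move=> x; rewrite indicE lern1 leq_b1.
have [mu [mu_open _]] := @content_measure_exists R (product_space X) _
  product_hausdorff dominated_compact_content L1 dominated_tight.
have muL (U : set PX) : open U -> mu U <= (L (\1_U)%R)%:E.
  move=> oU; apply: mu_open => // K cK KU.
  apply: dominated_le => [||x]; last exact: indic_le.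
    exact: B_nu_indic (mcompact cK).
  by apply: B_nu_indic; exact: (@open_borel (product_space X)).
have mu_nu : couplings nu (mu : probability (borel PX) R).
  move=> n A mA.
  pose pn : {mfun borel PX >-> borel (X n)} :=
    mfun_Sub (mem_set (@proj_borel I X n)).
  have := @borel_probability_eq R (X n) (distribution mu pn) (nu n).
  apply => //.
    exact: polish_open_Fsigma (X_polish n).
  move=> U oU; have mU : measurable (U : set (borel (X n))) by exact: open_borel.
  have oV : open (proj n @^-1` U : set PX).
    exact: (continuousP (proj n : PX -> X n)).1 (@proj_continuous I X n) U oU.
  apply: (le_trans (muL _ oV)); rewrite -[nu n U]add0e -sum_pairing_slice//.
  apply: L_dom => [||x].
  - by apply: B_nu_indic; exact: (@open_borel (product_space X)).
  - exact: slice_Gseq.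
  - by rewrite add0e; apply: le_trans (slice_ge U x).
exists mu; split => // f Bf uf [M fM].
(* The superlevel sets of [M - f >= 0] are open, so its staircases, hence its
   integral, are bounded by [L (M - f) = M - L f]. *)
pose w x := (M - f x)%R.
have mf : measurable_fun [set: borel PX] (f : borel PX -> R) by case: Bf.
have w0 x : (0 <= w x)%R by rewrite subr_ge0.
have Bw : B_nu nu w.
  rewrite (_ : w = (cst M \+ (fun x => -1 * f x))%R).
    by apply: B_nuD; [exact: Bcst|exact: B_nuZ].
  by apply/funext => x; rewrite /= mulN1r.
have intf := B_nu_integrable mu_nu Bf.
have : \int[mu]_x (w x)%:E <= (L w)%:E.
  apply: integral_le_layers => //; first exact: measurable_funB.
  move=> k N k0; pose A i := [set x : PX | i.+1%:R / k%:R < w x]%R.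
  have oA i : open (A i).
    rewrite (_ : A i = [set x | i.+1%:R / k%:R - M < - f x]%R).
      exact: usc_superlevelN_open.
    by apply/seteqP; split => x; rewrite /A /w /= ltrBlDl.
  have mA i : measurable (A i : set (borel PX)).
    exact: (@open_borel (product_space X)).
  apply: (@le_trans _ _ (\sum_(i < N) (L (\1_(A i))%R)%:E)).
    by apply: lee_sum => i _; apply: muL; exact: oA.
  have [BS LS] := L_sum N mA.
  rewrite sumEFin -LS -LZ// lee_fin; apply: dominated_le => //; first exact: B_nuZ.
  by move=> x; exact: sum_layers_le.
rewrite (LB (Bcst M) Bf) dominated_cst /pairing; under eq_integral do rewrite EFinB.
rewrite integralB//=; last first.
  exact: B_nu_integrable mu_nu (Bcst M).
rewrite integral_cst// [X in _ * X](_ : _ = 1); last exact: probability_setT.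
rewrite mule1; move: (integrable_fin_num measurableT intf) => /fineK <- /=.
by rewrite -EFinB !lee_fin; lra.
Qed.

End DominatedFunctionals.

(** * Duality *)

Section Duality.
Local Open Scope ring_scope.
Local Open Scope ereal_scope.
Context {R : realType} {I : countType} {X : I -> ptopologicalType}.
Context {nu : forall n, probability (borel (X n)) R}.
Context {phi : (prod_topology X -> R) -> R}.
Local Notation PX := (prod_topology X).
Implicit Types (g u : forall n, X n -> R) (f h : PX -> R).

Lemma U_plus_G_nu_split (n0 : I) f : B_nu nu f ->
  U_plus_G_nu nu (EFin \o f) -> exists h g G,
  [/\ U_nu nu h, Gseq nu g, B_nu nu G, f = (fun x => h x + G x)%R
    & forall x : PX, (G x)%:E = oplus g x].
Proof.
move=> Bf [h Uh [_ [g Gg <-] hgf]]; exists h, g, (fun x => f x - h x)%R; split => //.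
- rewrite (_ : (fun x => _) = (f \+ (fun x => -1 * h x))%R).
    by apply: B_nuD Bf _; apply: B_nuZ; exact: U_nu_B_nu.
  by apply/funext => x /=; rewrite mulN1r.
- by apply/funext => x; rewrite addrC subrK.
move=> x; have := congr1 (fun k => k x) hgf; rewrite /= EFinB => <-.
by rewrite addeAC subee// add0e.
Qed.

(** Testing the subgradient inequality along [f + t f'] with [t] large turns the
    bound on [phi] into one on [L], the contribution of [f] being divided by
    [t]. *)
Lemma subgradient_marginal_dominated f (L : (PX -> R) -> R) :
  marginal_dominated nu phi ->
  B_nu nu f -> (forall (t : R) h, B_nu nu h -> L (fun x => t * h x) = t * L h)%R ->
  (forall h, B_nu nu h -> phi f + L h <= phi (fun x => f x + h x))%R ->
  marginal_dominated nu L.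
Proof.
move=> phi_bound Bf LZ Lsub h m g Bh Gg hg.
have /B_nuP[_ [g0 Gg0 fg0]] := Bf.
rewrite -(fineK (sum_pairing_fin Gg)) -EFinD lee_fin.
set S := fine _; pose S0 := fine (sum_pairing nu g0).
have tS t : (0 < t -> phi f + t * L h <= t * m + (S0 + t * S))%R.
  move=> t0; rewrite -LZ//; apply: (le_trans (Lsub _ (B_nuZ t Bh))).
  rewrite -lee_fin !EFinD !EFinM !fineK ?sum_pairing_fin//.
  rewrite -sum_pairingZ ?(ltW t0)//; last exact: Gg.1.
  have GtZ := GseqZ (ltW t0) Gg.
  rewrite -sum_pairingD; [|exact: Gg0.1|exact: GtZ.1].
  rewrite -EFinM; apply: phi_bound.
  - exact: B_nuD Bf (B_nuZ t Bh).
  - exact: GseqD Gg0 GtZ.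
  move=> x; rewrite oplusD => [|n y|n y].
  - rewrite oplusZ ?(ltW t0)//; last by move=> n y; exact: (Gg.1 n).2.
    rewrite addeCA EFinD; apply: leeD.
      by apply: le_trans (fg0 x); rewrite lee_fin ler_norm.
    by rewrite !EFinM -muleDr//; apply: lee_wpmul2l => //; rewrite lee_fin ltW.
  - exact: (Gg0.1 n).2.
  - exact: (GtZ.1 n).2.
rewrite leNgt; apply/negP => mS; pose d := (L h - m - S)%R.
have d0 : (0 < d)%R by rewrite /d; lra.
have t0 : (0 < (`|S0 - phi f| + 1) / d)%R by rewrite divr_gt0// ltr_wpDl.
have := tS _ t0; have := ler_norm (S0 - phi f)%R.
set t := (_ / d)%R; have : (t * d = `|S0 - phi f| + 1)%R by rewrite divfK ?gt_eqF.
by rewrite /d !mulrBr; lra.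
Qed.

Lemma B_nu_subspace (n0 : I) : linear_subspace (B_nu nu : set (PX -> R^o)).
Proof.
split; first exact: B_nu_cst.
- exact: B_nuD.
- by move=> a f; exact: B_nuZ.
Qed.

Lemma exists_dominated_subgradient (n0 : I) f : B_nu nu f ->
  convex_on_B_nu nu phi ->
  marginal_dominated nu phi ->
  exists L : (PX -> R) -> R, [/\ linear_on_B_nu nu L,
    marginal_dominated nu L &
    forall h, B_nu nu h -> (phi f + L h <= phi (fun x => f x + h x))%R].
Proof.
move=> Bf phi_convex phi_bound.
have [L [LD LZ] Lsub] :=
  @convex_subgradient R (PX -> R^o) _ phi f (B_nu_subspace n0) Bf phi_convex.
exists L; split => //.
exact: (subgradient_marginal_dominated phi_bound Bf LZ Lsub).
Qed.

(** With [L] a subgradient at [f] and [mu] the coupling above [L] on upper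
    semicontinuous functions: applied to [- c] for [c] bounded continuous this
    gives [<c, mu> <= L c], and as [L (oplus g) <= sum_pairing nu g] is the
    integral of [oplus g], also [L f <= <f, mu>]. Hence
    [<c, mu> - phi c <= L c - phi c <= L f - phi f <= <f, mu> - phi f]. *)
Lemma subgradient_coupling_attains (n0 : I) f :
  (forall n, polish_space R (X n)) ->
  convex_on_B_nu nu phi ->
  marginal_dominated nu phi ->
  B_nu nu f -> U_plus_G_nu nu (EFin \o f) ->
  exists2 mu, couplings nu mu &
    (phi f)%:E <= pairing (f : borel PX -> R) mu -
      conjugate (bounded_continuous_functions R X) phi mu.
Proof.
move=> X_polish phi_convex phi_bound Bf UGf.
have [L [Ll Ld Lsub]] := exists_dominated_subgradient n0 Bf phi_convex phi_bound.
have [mu [mu_nu muL]] := dominated_functional_coupling X_polish n0 Ll Ld.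
exists mu => //; have [LD LZ] := Ll.
have Bint k (Bk : B_nu nu k) := B_nu_integrable mu_nu Bk.
have Bfin k (Bk : B_nu nu k) := integrable_fin_num measurableT (Bint k Bk).
have Lf : (L f)%:E <= pairing (f : borel PX -> R) mu.
  have [h [g [G [Uh Gg BG fhG GE]]]] := U_plus_G_nu_split n0 Bf UGf.
  have Bh := U_nu_B_nu n0 Uh.
  rewrite fhG /pairing; under eq_integral do rewrite EFinD.
  rewrite integralD//=; [|exact: Bint|exact: Bint].
  rewrite LD// EFinD; apply: leeD.
    have [[_ uh] [_ /bounded_fun_ex[M hM]] _] := Uh.
    apply: muL => //; exists M => x; apply: le_trans (hM x).
    by apply: le_trans (ler_norm _); rewrite /funrpos le_max lexx.
  under eq_integral do rewrite GE.
  rewrite (integral_oplus mu_nu Gg.1) -[leRHS]add0e.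
  by apply: Ld => // x; rewrite add0e GE.
have conj_le : conjugate (bounded_continuous_functions R X) phi mu <=
    pairing (f : borel PX -> R) mu - (phi f)%:E.
  apply: ge_ereal_sup => _ [c Cc <-]; have [cc /bounded_fun_ex[M cM]] := Cc.
  have Bc : B_nu nu c by exact: bounded_continuous_B_nu.
  have cL : pairing (c : borel PX -> R) mu <= (L c)%:E.
    have NcE : (fun x => -1 * c x)%R = (fun x => - c x)%R.
      by apply/funext => x; rewrite mulN1r.
    have BNc := B_nuZ (-1)%R Bc.
    have uNc : upper_semicontinuous (fun x => -1 * c x)%R.
      by rewrite NcE; apply: continuous_usc => x; apply: cvgN; exact: cc.
    have bNc : exists M : R, forall x, (-1 * c x <= M)%R.
      exists M => x; rewrite mulN1r; apply: le_trans (cM x).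
      by rewrite -normrN ler_norm.
    have := muL _ BNc uNc bNc.
    rewrite LZ// /pairing; under eq_integral do rewrite EFinM.
    rewrite integralZl//; last exact: Bint.
    by rewrite -(fineK (Bfin _ Bc)) -EFinM !lee_fin; lra.
  apply: (@le_trans _ _ ((L c)%:E - (phi c)%:E)); first exact: leeB.
  apply: (@le_trans _ _ ((L f)%:E - (phi f)%:E)); last exact: leeB.
  rewrite -!EFinB lee_fin.
  have BNf := B_nuZ (-1)%R Bf.
  have := Lsub _ (B_nuD Bc BNf); rewrite (LD _ _ Bc BNf) LZ//.
  rewrite (_ : (fun x => _) = c); last first.
    by apply/funext => x /=; rewrite mulN1r addrC subrK.
  lra.
have := Bfin _ Bf; move: conj_le; rewrite /pairing /=.
case: (\int[mu]_x (f x)%:E) => [r| |]//; case: conjugate => [s| |]//= rs _.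
  by move: rs; rewrite -!EFinB !lee_fin; lra.
by rewrite leey.
Qed.

(** [usc_minorant (u n) (u n)] says that [u n] is nonnegative, bounded, Borel and
    upper semicontinuous. *)
Lemma U_nu_add_usc (h : PX -> R) (s : seq I) u :
  U_nu nu h -> (forall n, usc_minorant (u n) (u n)) ->
  U_nu nu (fun x => h x + \sum_(n <- s) u n (proj n x))%R.
Proof.
move=> [[mh uh] [mhp /bounded_fun_ex[M hM]] Bhn] uP.
have u0 n x : (0 <= u n x)%R by have [_ _ _ /(_ x)/andP[]] := uP n.
have S0 x : (0 <= \sum_(n <- s) u n (proj n x) :> R)%R by exact: sumr_ge0.
have mS : measurable_fun [set: borel PX]
    ((fun x : PX => \sum_(n <- s) u n (proj n x))%R : borel PX -> R).
  apply: measurable_sum => n; have [mu _ _ _] := uP n.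
  exact: measurableT_comp mu (@proj_borel _ _ n).
have mk : borel_functions (fun x : PX => h x + \sum_(n <- s) u n (proj n x))%R.
  exact: measurable_funD.
split.
- split => //; apply: usc_add => //; apply: usc_sum => n.
  have [_ un _ _] := uP n.
  exact: (@usc_comp _ _ PX (proj n) _ (@proj_continuous _ _ n) un).
- split; first exact: measurable_funrpos.
  have /choice[N uN] n : exists N : R, forall x, (u n x <= N)%R.
    by have [_ _ bu _] := uP n.
  exists (M + \sum_(n <- s) N n)%R; split; first exact: num_real.
  move=> c Mc x _; apply: le_trans (ltW Mc).
  rewrite ger0_norm ?funrpos_ge0// /funrpos ge_max; apply/andP; split.
    apply: lerD; last exact: ler_sum.
    apply: le_trans (hM x); apply: le_trans (ler_norm _).
    by rewrite /funrpos le_max lexx.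
  apply: addr_ge0; first exact: le_trans (normr_ge0 _) (hM x).
  apply: sumr_ge0 => n _; exact: le_trans (u0 n (proj n x)) (uN n _).
- apply: (B_nu_le _ Bhn) => [|x]; first exact: measurable_funrneg.
  rewrite !ger0_norm ?funrneg_ge0// /funrneg ge_max !le_max lexx orbT andbT.
  apply/orP; left; by rewrite lerN2 lerDl.
Qed.

(** Replacing finitely many [g n] by bounded upper semicontinuous minorants gives
    an element of [U_nu] below [f]; the integrals lost are controlled by summable
    weights, uniformly in the finite set of indices. *)
Lemma coupling_le (n0 : I) f (mu : probability (borel PX) R) :
  (forall n, polish_space R (X n)) -> increasing_on_B_nu nu phi ->
  couplings nu mu -> B_nu nu f -> U_plus_G_nu nu (EFin \o f) ->
  pairing (f : borel PX -> R) mu - conjugate (U_nu nu) phi mu <= (phi f)%:E.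
Proof.
move=> X_polish phi_incr mu_nu Bf UGf.
have [h [g [G [Uh Gg BG fhG GE]]]] := U_plus_G_nu_split n0 Bf UGf.
have Bh := U_nu_B_nu n0 Uh.
have Bint k (Bk : B_nu nu k) := B_nu_integrable mu_nu Bk.
have Bfin k (Bk : B_nu nu k) := integrable_fin_num measurableT (Bint k Bk).
have g0 n x := (Gg.1 n).2 x.
have conj_ge k : U_nu nu k ->
    pairing (k : borel PX -> R) mu - (phi k)%:E <= conjugate (U_nu nu) phi mu.
  by move=> Uk; apply: ereal_sup_ubound; exists k.
have fE : pairing (f : borel PX -> R) mu =
    pairing (h : borel PX -> R) mu + sum_pairing nu g.
  rewrite fhG /pairing; under eq_integral do rewrite EFinD.
  rewrite integralD//=; [|exact: Bint|exact: Bint]; congr (_ + _).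
  by under eq_integral do rewrite GE; exact: integral_oplus mu_nu Gg.1.
have pg_fin n : pairing (g n : borel (X n) -> R) (nu n) \is a fin_num.
  rewrite ge0_fin_numE; last exact: pairing_ge0.
  apply: le_lt_trans Gg.2.
  exact: (@esum_ge_term _ _ (fun n => pairing (g n : borel (X n) -> R) (nu n))).
have := conj_ge h Uh.
case C : (conjugate (U_nu nu) phi mu) => [c| |] hc; first last.
- move: hc; rewrite /pairing -(fineK (Bfin _ Bh)) /= -EFinB.
  by rewrite leeNy_eq.
- rewrite fE -(fineK (sum_pairing_fin Gg)) /pairing -(fineK (Bfin _ Bh)).
  by rewrite -EFinD leNye.
rewrite leeBlDr//; apply/lee_addgt0Pr => e e0.
have [w [w0 we]] := @countable_weights R I e e0.
have le_sub (a b : \bar R) (r : R) : a \is a fin_num -> b + r%:E <= a ->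
    b <= (fine a - r)%:E.
  by move=> fa; rewrite EFinB fineK// leeBrDr.
have umin n : exists un, usc_minorant (g n) un /\
    pairing (g n : borel (X n) -> R) (nu n) <=
    pairing (un : borel (X n) -> R) (nu n) + (w n)%:E.
  apply: contrapT => /forallNP noU.
  have : pairing (g n : borel (X n) -> R) (nu n) <=
      (fine (pairing (g n : borel (X n) -> R) (nu n)) - w n)%:E.
    apply: integral_le_usc_minorants => //; first exact: (Gg.1 n).1.
    move=> un unP; have /not_andP[//|/negP] := noU un.
    by rewrite -ltNge => /ltW; exact: le_sub.
  by rewrite -[leLHS](fineK (pg_fin n)) lee_fin; have := w0 n; lra.
pose u n := sval (cid (umin n)).
have uP n : usc_minorant (g n) (u n) by have [] := svalP (cid (umin n)).
have gu n : pairing (g n : borel (X n) -> R) (nu n) <=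
    pairing (u n : borel (X n) -> R) (nu n) + (w n)%:E.
  by have [] := svalP (cid (umin n)).
have u0 n x : (0 <= u n x)%R by have [_ _ _ /(_ x)/andP[]] := uP n.
have uB n : nonneg_borel_functions (u n) by split => //; have [] := uP n.
rewrite fE addeC -leeBrDr; last exact: Bfin _ Bh.
apply: ge_ereal_sup => _ [J [finJ _] <-]; rewrite leeBrDr; last exact: Bfin _ Bh.
rewrite fsbig_finite//=; set s := fset_set J.
pose k x := (h x + \sum_(n <- s) u n (proj n x))%R.
have Uk : U_nu nu k.
  apply: U_nu_add_usc => // n; have [mu' uu bu _] := uP n; split => // x.
  by rewrite u0 lexx.
have Bk := U_nu_B_nu n0 Uk.
have kf : (phi k <= phi f)%R.
  apply: phi_incr => // x; rewrite /k fhG lerD2l -lee_fin GE.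
  apply: esum_ge; exists J => //; rewrite fsbig_finite//= -sumEFin.
  apply: lee_sum => n _; rewrite lee_fin.
  by have [_ _ _ /(_ (proj n x))/andP[]] := uP n.
have ws : \sum_(n <- s) (w n)%:E <= e%:E.
  apply: le_trans we; apply: esum_ge; exists J => //.
  by rewrite fsbig_finite.
have kE : pairing (k : borel PX -> R) mu = pairing (h : borel PX -> R) mu +
    \sum_(n <- s) pairing (u n : borel (X n) -> R) (nu n).
  have mun n : measurable_fun [set: borel PX]
      ((fun x : PX => u n (proj n x)) : borel PX -> R).
    exact: measurableT_comp (uB n).1 (@proj_borel _ _ n).
  have BS : B_nu nu (fun x : PX => \sum_(n <- s) u n (proj n x))%R.
    rewrite (_ : (fun x => _) = (k \+ (fun x => -1 * h x))%R).
      exact: B_nuD Bk (B_nuZ (-1)%R Bh).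
    by apply/funext => x; rewrite /k /= mulN1r addrC addKr.
  rewrite /pairing /k; under eq_integral do rewrite EFinD.
  rewrite integralD//=; [|exact: Bint|exact: Bint]; congr (_ + _).
  under eq_integral do rewrite -sumEFin.
  rewrite ge0_integral_sum//.
  - by apply: eq_bigr => n _; exact: pairing_marginal.
  - by move=> n; apply/measurable_EFinP; exact: mun.
  - by move=> n x _; rewrite lee_fin.
have := conj_ge k Uk; rewrite C => kc.
apply: (@le_trans _ _ (pairing (k : borel PX -> R) mu + e%:E)).
  rewrite kE -addeA addeC; apply: leeD => //.
  apply: (@le_trans _ _ (\sum_(n <- s)
      (pairing (u n : borel (X n) -> R) (nu n) + (w n)%:E))).
    by apply: lee_sum => n _; exact: gu.
  by rewrite big_split/=; apply: leeD.
apply: leeD => //; move: kc; rewrite leeBlDr// => /le_trans; apply.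
by rewrite addeC; apply: leeD => //; rewrite lee_fin.
Qed.

End Duality.

Local Open Scope ereal_scope.

Theorem proposition3p2 (R : realType) (I : countType)
    (I_nonempty : [set: I] !=set0)
    (X : I -> ptopologicalType)
    (X_polish : forall n, polish_space R (X n))
    (nu : forall n, probability (borel (X n)) R)
    (phi : (prod_topology X -> R) -> R)
    (phi_increasing : increasing_on_B_nu nu phi)
    (phi_convex : convex_on_B_nu nu phi)
    (phi_bound : forall f (m : R) g, B_nu nu f -> Gseq nu g ->
       (forall x, (f x)%:E <= m%:E + oplus g x) ->
       (phi f)%:E <= m%:E + sum_pairing nu g)
    (phi_conjugate : forall mu, couplings nu mu ->
       conjugate (bounded_continuous_functions R X) phi mu =
       conjugate (U_nu nu) phi mu) :
  forall f, B_nu nu f -> U_plus_G_nu nu (EFin \o f) ->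
    is_maximum
      [set pairing (f : borel (prod_topology X) -> R) mu -
           conjugate (bounded_continuous_functions R X) phi mu
         | mu in couplings nu]
      (phi f)%:E.
Proof.
move=> f Bf UGf; have [n0 _] := I_nonempty; split.
  have [mu mu_nu le_phi] :=
    subgradient_coupling_attains n0 X_polish phi_convex phi_bound Bf UGf.
  exists mu => //; apply/eqP; rewrite eq_le le_phi andbT phi_conjugate//.
  exact: (coupling_le n0 X_polish phi_increasing mu_nu Bf UGf).
move=> _ [mu mu_nu <-]; rewrite phi_conjugate//.
exact: (coupling_le n0 X_polish phi_increasing mu_nu Bf UGf).
Qed.
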